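(* Let $T>0$, let $a,b\in[0,T]$ with $a<b$, and let $f\in H^1(a,b)\subset C[a,b]$. Define $v_f\in L^2(0,T)$ by $v_f(s)=f(s)$ for $s\in[a,b]$ and $v_f(s)=0$ otherwise. Then the modified Hilbert transformation $\mathcal H_T$ allows the integral representation $$(\mathcal H_T v_f)(t) = -f(b)\,\mathcal K(b,t) + f(a)\,\mathcal K(a,t) + \int_a^b \partial_t f(s)\,\mathcal K(s,t)\,\mathrm ds \qquad\text{for } t\in(0,T)\setminus\{a,b\},$$ where the integral exists as a weakly singular integral. If, in addition, $f(a)=0$, then $$(\mathcal H_T v_f)(a) = -f(b)\,\mathcal K(b,a) + \int_a^b \partial_t f(s)\,\mathcal K(s,a)\,\mathrm ds$$ holds true, with the integral existing as a weakly singular integral. Analogously, if $f(b)=0$, then $$(\mathcal H_T v_f)(b) = f(a)\,\mathcal K(a,b) + \int_a^b \partial_t f(s)\,\mathcal K(s,b)\,\mathrm ds$$ holds true, with the integral existing as a weakly singular integral.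
   Context: $H^1(a,b)$ is the usual Sobolev space on the interval $(a,b)$; its elements are identified with their continuous representatives on $[a,b]$, and $\partial_t f$ denotes the weak derivative of $f$. The modified Hilbert transformation $\mathcal H_T: L^2(0,T)\to L^2(0,T)$ is defined by $$(\mathcal H_T v)(t)=\sum_{k=0}^\infty v_k \cos\left(\left(\frac{\pi}{2}+k\pi\right)\frac{t}{T}\right),\quad t\in(0,T),\qquad v_k=\frac{2}{T}\int_0^T v(t)\sin\left(\left(\frac{\pi}{2}+k\pi\right)\frac tT\right)\mathrm dt .$$ Pointwise values of $\mathcal H_T v$ are understood through the (previously known) Cauchy principal value representation, valid for $v\in L^2(0,T)$: $$(\mathcal H_T v)(t)=\mathrm{v.p.}\int_0^T v(s)\,K(s,t)\,\mathrm ds=\lim_{\varepsilon\searrow0}\int_{\{s\in(0,T):\,|s-t|>\varepsilon\}}v(s)K(s,t)\,\mathrm ds,$$ $$K(s,t)=\frac1{2T}\left[\frac{1}{\sin\frac{\pi(s+t)}{2T}}+\frac1{\sin\frac{\pi(s-t)}{2T}}\right].$$ The kernel $\mathcal K$ is $$\mathcal K(s,t)=-\frac1\pi\ln\left[\tan\frac{\pi(s+t)}{4T}\,\tan\frac{\pi|t-s|}{4T}\right].$$ ''Weakly singular integral'' means that the integrand is Lebesgue integrable (its kernel has at most a logarithmic singularity), so no principal value is needed. *)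

(* Defs.v *)
(* MathComp-Analysis; functions on an interval are total functions R -> R whose
   values off the interval are irrelevant. *)
From HB Require Import structures.
From mathcomp Require Import all_boot all_order all_algebra.
From mathcomp Require Import all_classical all_reals all_analysis.

Set Implicit Arguments.
Unset Strict Implicit.
Unset Printing Implicit Defensive.
Import Order.TTheory GRing.Theory Num.Theory.
Import numFieldNormedType.Exports.
Local Open Scope classical_set_scope.
Local Open Scope ring_scope.

Definition zero_ext (R : realType) (A : set R) (f : R -> R) : R -> R :=
  patch (fun=> 0) A f.

Definition L2_on (R : realType) (a b : R) (f : R -> R) : Prop :=
  zero_ext `]a, b[ f \in Lfun (@lebesgue_measure R) 2%:E.

(* phi is in C_c^oo(a, b), extended by 0 to the whole line *)
Definition test_function (R : realType) (a b : R) (phi : R -> R) : Prop :=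
  [/\ forall (n : nat) (x : R), derivable (derive1n n phi) x 1,
      compact (closure [set x | phi x != 0]) &
      closure [set x | phi x != 0] `<=` `]a, b[].

(* only used for f and g in L^2(a, b), where the two integrands are integrable *)
Definition weak_derivative (R : realType) (a b : R) (f g : R -> R) : Prop :=
  forall phi : R -> R, test_function a b phi ->
    (\int[@lebesgue_measure R]_(x in `]a, b[) (f x * derive1 phi x) =
     - \int[@lebesgue_measure R]_(x in `]a, b[) (g x * phi x)).

Definition sobolev_H1 (R : realType) (a b : R) (f : R -> R) : Prop :=
  L2_on a b f /\ exists2 g, L2_on a b g & weak_derivative a b f g.

Definition mhilbert_freq (R : realType) (k : nat) : R := pi / 2 + k%:R * pi.

Definition mhilbert_coef (R : realType) (T : R) (v : R -> R) (k : nat) : R :=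
  2 / T * \int[@lebesgue_measure R]_(t in `]0, T[)
            (v t * sin (mhilbert_freq R k * (t / T))).

Definition mhilbert_psum (R : realType) (T : R) (v : R -> R) (n : nat)
    (t : R) : R :=
  \sum_(k < n) mhilbert_coef T v k * cos (mhilbert_freq R k * (t / T)).

(* h represents the L^2(0, T) class of the sum of the series defining H_T v *)
Definition mhilbert_series (R : realType) (T : R) (v h : R -> R) : Prop :=
  L2_on 0 T h /\
  Lnorm (@lebesgue_measure R) 2%:E
    (EFin \o zero_ext `]0, T[ (fun t => h t - mhilbert_psum T v n t))
    @[n --> \oo] --> 0%E.

Definition mhilbert_kernel (R : realType) (T s t : R) : R :=
  (2 * T)^-1 * ((sin (pi * (s + t) / (2 * T)))^-1
              + (sin (pi * (s - t) / (2 * T)))^-1).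

Definition mhilbert_trunc (R : realType) (T : R) (v : R -> R) (t eps : R) : R :=
  \int[@lebesgue_measure R]_(s in [set s | 0 < s < T /\ eps < `|s - t|])
    (v s * mhilbert_kernel T s t).

Definition mhilbert_pv_exists (R : realType) (T : R) (v : R -> R) (t : R) :
    Prop :=
  cvg (mhilbert_trunc T v t eps @[eps --> 0^'+]).

(* H_T v as a function defined everywhere: its value at t is the Cauchy
   principal value whenever the latter exists.  For v in L^2(0, T) this is the
   case almost everywhere on (0, T), and the principal value then represents
   the sum of the series; on the remaining null set the value is that of an
   arbitrary representative of this sum. *)
Definition mhilbert (R : realType) (T : R) (v : R -> R) (t : R) : R :=
  if `[< mhilbert_pv_exists T v t >]
  then lim (mhilbert_trunc T v t eps @[eps --> 0^'+])
  else get (mhilbert_series T v) t.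

Definition log_kernel (R : realType) (T s t : R) : R :=
  - pi^-1 * ln (tan (pi * (s + t) / (4 * T)) * tan (pi * `|t - s| / (4 * T))).

Definition log_kernel_integrable (R : realType) (T a b : R) (g : R -> R)
    (t : R) : Prop :=
  (@lebesgue_measure R).-integrable `]a, b[
    (EFin \o (fun s => g s * log_kernel T s t)).

Definition log_kernel_integral (R : realType) (T a b : R) (g : R -> R)
    (t : R) : R :=
  \int[@lebesgue_measure R]_(s in `]a, b[) (g s * log_kernel T s t).

(* Main.v *)
(* The weak derivative is tested against smooth plateau functions that converge
   to the indicator of [x, y] and whose derivatives are a difference of two
   mollifiers concentrating at x and y; hence f y - f x is the integral of df
   over [x, y], and |f y - f x| = O(sqrt (y - x)) as df is square integrable.
   Since K(., t) is minus the derivative of the logarithmic kernel off s = t,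
   integration by parts applies to the truncated integral on either side of t.
   The logarithmic kernel is O(|s - t|^(-1/4)), uniformly on [0, T]^2: it is
   therefore square integrable in s, so that df times the kernel is integrable,
   and the boundary terms at t - eps and t + eps are f t times the kernel up to
   O(eps^(1/2) * eps^(-1/4)).  At an interior t the two remaining terms cancel
   in the limit by the symmetry of |s - t|; at an endpoint t where f vanishes
   the single remaining term is 0. *)

(* Integration by parts is the delicate point: [f] is only absolutely continuous, so the product
   with the logarithmic kernel has no pointwise derivative to feed to the fundamental theorem.
   Instead the defect of the formula, an additive function of the interval, is shown to be O((y -
   x)^(3/2)): the bounded derivative of the smooth factor gives y - x, the Hölder bound on [f] the
   extra half power. Cutting into 2^n equal pieces then forces the defect to vanish. The exponent
   1/4 is a choice. Any positive exponent below 1/2 dominates the logarithm, has an integrable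
   square and loses against the Hölder exponent 1/2 of [f]; 1/4 is a nested square root, and its
   square |s - t|^(-1/2) has an elementary primitive. Each boundary term at [t] may diverge on its
   own, so the one-sided limits are stated with a compensating multiple [f t] of the kernel. The
   compensations cancel because the singular factor tan(pi eps / (4 T)) is common to both sides; the
   other factor is continuous at eps = 0 only for 0 < t < T, hence the separate treatment of the
   endpoints. *)
Require Import Defs.
From HB Require Import structures.
From mathcomp Require Import all_boot all_order all_algebra.
From mathcomp Require Import all_classical all_reals all_analysis.
From mathcomp Require Import measurable_realfun ring lra.

Set Implicit Arguments.
Unset Strict Implicit.
Unset Printing Implicit Defensive.
Import Order.TTheory GRing.Theory Num.Theory.
Import numFieldNormedType.Exports.
Local Open Scope classical_set_scope.
Local Open Scope ring_scope.

(** * A smooth step function *)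

Section SmoothFunctions.
Context {R : realType}.
Implicit Types f g : R -> R.

(* Cn n f: f is n + 1 times differentiable. *)
Fixpoint Cn (n : nat) f : Prop :=
  match n with
  | 0 => forall x : R, derivable f x (1 : R)
  | m.+1 => exists2 f' : R -> R,
      (forall x : R, is_derive x (1 : R) f (f' x)) & Cn m f'
  end.

Definition smooth f : Prop := forall n, Cn n f.

Lemma CnW n f : Cn n.+1 f -> Cn n f.
Proof.
elim: n f => [|n IH] f [f' df cf]; first by move=> x; case: (df x).
by exists f' => //; exact: IH.
Qed.

Lemma Cn_derivable n f : Cn n f -> forall x, derivable f x 1.
Proof. by case: n => // n [f' df _] x; case: (df x). Qed.

Lemma smooth_derivable f : smooth f ->
  forall n x, derivable (derive1n n f) x 1.
Proof.
move=> sf n; move: (sf n); elim: n f {sf} => // n IH f [f' df cf] x.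
rewrite derive1Sn (_ : derive1 f = f'); first exact: IH.
by apply/funext => y; rewrite derive1E; exact: (@derive_val _ _ _ _ _ _ _ (df y)).
Qed.

Lemma Cn_cst n (c : R) : Cn n (cst c).
Proof.
elim: n c => [|n IH] c; first by move=> x; exact: derivable_cst.
by exists (cst 0) => // x; exact: is_derive_cst.
Qed.

Lemma CnD n f g : Cn n f -> Cn n g -> Cn n (f \+ g).
Proof.
elim: n f g => [|n IH] f g; first by move=> df dg x; exact: derivableD.
move=> [f' df cf] [g' dg cg]; exists (f' \+ g'); last exact: IH.
by move=> x; exact: is_deriveD.
Qed.

Lemma CnM n f g : Cn n f -> Cn n g -> Cn n (f \* g).
Proof.
elim: n f g => [|n IH] f g; first by move=> df dg x; exact: derivableM.
move=> /[dup] /CnW cnf [f' df cf] /[dup] /CnW cng [g' dg cg].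
exists ((f \* g') \+ (g \* f')); last by apply: CnD; exact: IH.
by move=> x; exact: is_deriveM.
Qed.

Lemma CnV n f : (forall x, f x != 0) -> Cn n f ->
  Cn n (fun x => (f x)^-1).
Proof.
move=> f0; elim: n => [|n IH]; first by move=> df x; exact: derivableV.
move=> /[dup] /CnW /IH cnf [f' df cf].
(* The derivative of the reciprocal is spelled as a product of reciprocals of [f] with [f'], so that
   [CnM] and the induction hypothesis [cnf] cover it. *)
exists ((cst (-1) \* ((fun x => (f x)^-1) \* (fun x => (f x)^-1))) \* f').
  move=> x; apply: (is_derive_eq (is_deriveV (f0 x) (df x))).
  by rewrite /= /GRing.scale /= mulN1r expr2 invfM.
by do !apply: CnM => //; exact: Cn_cst.
Qed.

Lemma Cn_affine n f (c d : R) : Cn n f -> Cn n (fun x => f (c * x + d)).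
Proof.
have da (x : R) : is_derive x (1 : R) (fun x => c * x + d) c.
  by apply: is_derive_eq; rewrite scaler1 addr0.
elim: n f => [|n IH] f.
  move=> df x; by case: (@is_derive1_comp _ _ (fun x => c * x + d) _ _ _
      (derivableP (df (c * x + d))) (da x)).
move=> [f' df cf]; exists ((fun x => f' (c * x + d)) \* cst c).
  by move=> x; exact: (@is_derive1_comp _ f (fun x => c * x + d)).
by apply: CnM; [exact: IH|exact: Cn_cst].
Qed.

(** The power is controlled by a single term of the exponential series of [expR y]. *)
Lemma exprn_expRN_le (n : nat) (y : R) : 0 <= y -> y ^+ n * expR (- y) <= n`!%:R.
Proof.
move=> y0; rewrite expRN ler_pdivrMr ?expR_gt0//.
case: n => [|n]; first by rewrite expr0 fact0 mul1r -expR0 ler_expR.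
rewrite -ler_pdivrMl ?ltr0n ?fact_gt0// mulrC.
by have := expR_ge1Dxn n y0; apply: le_trans; rewrite lerDr.
Qed.

Lemma horner_expRN_le (p : {poly R}) :
  exists C : R, forall y, 0 <= y -> `|p.[y] * expR (- y)| <= C.
Proof.
exists (\sum_(i < size p) `|p`_i| * i`!%:R) => y y0.
rewrite horner_coef mulr_suml (le_trans (ler_norm_sum _ _ _))//.
apply: ler_sum => i _; rewrite -mulrA normrM ler_wpM2l//.
by rewrite ger0_norm ?exprn_expRN_le// mulr_ge0 ?exprn_ge0// expR_ge0.
Qed.

(* Flat at 0 whatever the polynomial p; this family is stable under derivation,
   which gives smoothness. *)
Definition expRNV (p : {poly R}) (x : R) : R :=
  if 0 < x then p.[x^-1] * expR (- x^-1) else 0.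

Lemma expRNV_derive p x :
  is_derive (x : R) (1 : R) (expRNV p) (expRNV ('X^2 * (p - p^`())) x).
Proof.
have [x0|x0|->] := ltgtP x 0.
- apply: (near_eq_is_derive (f := cst 0)).
    near=> z; rewrite /expRNV ifF//; apply/negbTE; rewrite -leNgt ltW//.
    by near: z; exact: lt_nbhsl.
  by rewrite /expRNV ltNge ltW//=; exact: is_derive_cst.
- apply: (near_eq_is_derive (f := fun z : R => p.[z^-1] * expR (- z^-1))).
    near=> z; rewrite /expRNV ifT//.
    by near: z; exact: lt_nbhsr.
  have dV : is_derive x (1 : R) (fun z : R => z^-1) (- x ^- 2 *: 1).
    by apply: is_deriveV; rewrite ?gt_eqF.
  have d1 := is_derive1_comp (is_derive_poly p x^-1) dV.
  have d2 := @is_derive1_comp _ expR (fun z : R => - z^-1) _ _ _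
    (is_derive_expR (- x^-1)) (is_deriveN dV).
  apply: (is_derive_eq (is_deriveM d1 d2)).
  rewrite /expRNV x0 !hornerE /GRing.scale /= !mulr1 exprVn; ring.
(* The difference quotient at 0 is again a member of the family, for ['X * p]. It tends to 0 because
   it is [z] times the member for ['X^2 * p], which is bounded. *)
- apply/is_derive1_caratheodory; exists (expRNV ('X * p)); split.
  + move=> z; rewrite /expRNV ltxx !subr0; case: ifPn => [z0|_]; last by rewrite mul0r.
    by rewrite !hornerE [RHS]mulrC !mulrA divff ?mul1r// gt_eqF.
  + have [C pC] := horner_expRN_le ('X^2 * p).
    have C0 : 0 <= C by apply: le_trans (pC _ (lexx _)).
    rewrite /prop_for /continuous_at {2}/expRNV ltxx.
    apply/cvgrPdist_le => e e0; near=> z.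
    rewrite /expRNV sub0r normrN; case: ifPn => [z0|_]; last by rewrite normr0 ltW.
    have -> : ('X * p).[z^-1] = z * ('X^2 * p).[z^-1].
      by rewrite hornerM hornerX hornerM hornerXn expr2 !mulrA divff ?mul1r// gt_eqF.
    rewrite -mulrA normrM (le_trans (ler_wpM2l _ (pC _ _)))//.
      by rewrite invr_ge0 ltW.
    apply: (@le_trans _ _ (`|z| * (C + 1))); first by rewrite ler_wpM2l// lerDl.
    rewrite -ler_pdivlMr ?ltr_wpDl//.
    near: z; apply: (cvgr0_norm_le (@idfun R)); first exact: cvg_id.
    by rewrite divr_gt0// ltr_wpDl.
  + by rewrite /expRNV ltxx.
Unshelve. all: by end_near. Qed.

Lemma expRNV_smooth p : smooth (expRNV p).
Proof.
move=> n; elim: n p => [|n IH] p; first by move=> x; case: (expRNV_derive p x).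
by exists (expRNV ('X^2 * (p - p^`()))) => //; exact: expRNV_derive.
Qed.

(** The classical quotient [g x / (g x + g (1 - x))] with [g x = expR (- x^-1)] for positive [x] and
    0 otherwise; the denominator never vanishes because [x] and [1 - x] are not both nonpositive. *)
Lemma smooth_step : exists S : R -> R,
  [/\ smooth S, forall x, x <= 0 -> S x = 0, forall x, 1 <= x -> S x = 1 &
      forall x, 0 <= S x <= 1].
Proof.
pose g := expRNV 1.
have g_ge0 x : 0 <= g x.
  by rewrite /g /expRNV; case: ifP => // _; rewrite hornerE mul1r expR_ge0.
have g_gt0 x : 0 < x -> 0 < g x.
  by rewrite /g /expRNV => ->; rewrite hornerE mul1r expR_gt0.
have g0 x : x <= 0 -> g x = 0 by rewrite /g /expRNV ltNge => ->.
pose h x := g x + g (- 1 * x + 1).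
have h_gt0 x : 0 < h x.
  rewrite /h; have [x0|x0] := ltP 0 x; first by rewrite ltr_pwDl ?g_gt0.
  by rewrite ltr_wpDl// g_gt0//; lra.
exists (g \* (fun x => (h x)^-1)); split.
- move=> n; apply: CnM; first exact: expRNV_smooth.
  apply: CnV; first by move=> x; rewrite gt_eqF.
  apply: CnD; first exact: expRNV_smooth.
  by apply: Cn_affine; exact: expRNV_smooth.
- by move=> x x0; rewrite /= g0 ?mul0r.
- move=> x x1; have h0 := h_gt0 x; rewrite /= /h (g0 (- 1 * x + 1)) ?addr0; last lra.
  by rewrite divff// gt_eqF// g_gt0//; lra.
- move=> x; apply/andP; split; first by apply: divr_ge0 => //; exact/ltW.
  by rewrite /= ler_pdivrMr// mul1r lerDl.
Qed.

End SmoothFunctions.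

(** * Weak derivatives *)

Section L2.
Context {R : realType}.
Notation mu := (@lebesgue_measure R).
Implicit Types (f g h : R -> R) (a b c d x y t : R).

Lemma within_continuous_ex (A : set R) f x (e : R) :
  {within A, continuous f} -> A x -> 0 < e ->
  exists2 r : R, 0 < r & forall t, A t -> `|t - x| < r -> `|f t - f x| <= e.
Proof.
move=> /subspace_continuousP cf Ax e0.
have /cvgrPdist_le/(_ _ e0) := cf _ Ax.
rewrite near_withinE => /nbhs_ballP[r/= r0 H].
exists r => // t At txr; rewrite distrC; apply: H => //.
by rewrite /ball/= distrC.
Qed.

Lemma L2_on_measurable a b g : L2_on a b g ->
  measurable_fun setT (zero_ext `]a, b[ g).
Proof. by rewrite /L2_on inE => /andP[]; rewrite inE. Qed.

Lemma L2_on_sqr_integrable a b g : L2_on a b g ->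
  mu.-integrable setT (EFin \o (fun x => zero_ext `]a, b[ g x ^+ 2)).
Proof. exact: Lfun2_integrable_sqr. Qed.

(** Pointwise [|g| <= 1 + g ^ 2], and the constant 1 is integrable on a bounded interval. *)
Lemma L2_on_integrable a b g : L2_on a b g ->
  mu.-integrable setT (EFin \o zero_ext `]a, b[ g).
Proof.
move=> g2; have mg := L2_on_measurable g2.
have i1 : mu.-integrable setT
    (EFin \o (fun x => \1_(`]a, b[) x + zero_ext `]a, b[ g x ^+ 2)).
  rewrite (_ : _ \o _ = (EFin \o \1_(`]a, b[)) \+
      (EFin \o (fun x => (zero_ext `]a, b[ g x ^+ 2)%R)))%E; last by apply/funext.
  apply: integrableD => //; last exact: L2_on_sqr_integrable.
  exact: integrable_indic_itv.
apply: le_integrable i1 => //; first exact/measurable_EFinP.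
move=> x _ /=; rewrite lee_fin [leRHS]ger0_norm; last by rewrite addr_ge0 ?sqr_ge0.
rewrite /zero_ext patchE indicE; case: ifPn => _.
  by rewrite mulr1n; have := sqr_ge0 (`|g x| - 1); have := normr_ge0 (g x);
     rewrite -[g x ^+ 2]real_normK ?num_real//; nra.
by rewrite normr0 expr0n addr0.
Qed.

End L2.

(** * Approximation of point values by a mollifier *)

Section Mollifier.
Context {R : realType}.
Notation mu := (@lebesgue_measure R).
Implicit Types (f g h S s : R -> R) (a b c d x y t : R).

Lemma is_derive_continuous f f' x : is_derive x (1 : R) f (f' x) ->
  {for x, continuous f}.
Proof. by case=> df _; exact/differentiable_continuous/derivable1_diffP. Qed.

Lemma Rintegral_itvcc_cst x y (k : R) : x <= y ->
  \int[mu]_(t in `[x, y]) k = k * (y - x).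
Proof.
move=> xy; rewrite Rintegral_cst//; congr (_ * _).
have h := lebesgue_measure_itv `[x, y]; rewrite [X in fine X]h.
case: ifPn => //=; rewrite lte_fin -leNgt => yx.
by apply/esym/eqP; rewrite subr_eq0 eq_le xy yx.
Qed.

Lemma integrable_EFinD (D : set (measurableTypeR R)) f g : measurable D ->
  mu.-integrable D (EFin \o f) -> mu.-integrable D (EFin \o g) ->
  mu.-integrable D (EFin \o (fun x => f x + g x)).
Proof. by move=> mD fi gi; exact: (integrableD mD fi gi). Qed.

Lemma integrable_EFinB (D : set (measurableTypeR R)) f g : measurable D ->
  mu.-integrable D (EFin \o f) -> mu.-integrable D (EFin \o g) ->
  mu.-integrable D (EFin \o (fun x => f x - g x)).
Proof. by move=> mD fi gi; exact: (integrableB mD fi gi). Qed.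

Lemma within_continuousM (A : set R) f g : {within A, continuous f} ->
  {within A, continuous g} -> {within A, continuous (fun x => f x * g x)}.
Proof. by move=> cf cg x; apply: continuousM; [exact: cf|exact: cg]. Qed.

Lemma within_continuous_norm (A : set R) f : {within A, continuous f} ->
  {within A, continuous (fun x => `|f x|)}.
Proof.
by move=> cf x; apply: continuous_comp; [exact: cf|exact: norm_continuous].
Qed.

Lemma within_continuous_cst (A : set R) (k : R) :
  {within A, continuous (fun=> k)}.
Proof. by apply: continuous_subspaceT; exact: cst_continuous. Qed.

(** The derivative [s] serves as mollifier profile. It vanishes off [[0, 1]], where [S] is locally
    constant, so the maximum of its absolute value on [[0, 1]] bounds it everywhere. *)
Lemma smooth_step_derive : exists (S s : R -> R) (M : R),
  [/\ smooth S, forall x : R, is_derive x (1 : R) S (s x), continuous s,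
      forall x, `|s x| <= M & forall x, ~~ (0 <= x <= 1) -> s x = 0]
  /\ [/\ forall x, x <= 0 -> S x = 0, forall x, 1 <= x -> S x = 1 &
      forall x, 0 <= S x <= 1].
Proof.
have [S [sS S0 S1 S01]] := @smooth_step R.
have [s dS [s' ds _]] := sS 2.
have cs : continuous s by move=> x; exact: is_derive_continuous (ds x).
have sout x : ~~ (0 <= x <= 1) -> s x = 0.
  rewrite negb_and -!ltNge => /orP[x0|x1].
    have S_eq0 : \near x, cst 0 x = S x.
      by near=> z; rewrite S0//; apply: ltW; near: z; exact: lt_nbhsl.
    have d0 := near_eq_is_derive S_eq0 (is_derive_cst (0 : R) x (1 : R)).
    by rewrite -[LHS](@derive_val _ _ _ _ _ _ _ (dS x)) (@derive_val _ _ _ _ _ _ _ d0).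
  have S_eq1 : \near x, cst 1 x = S x.
    by near=> z; rewrite S1//; apply: ltW; near: z; exact: lt_nbhsr.
  have d1 := near_eq_is_derive S_eq1 (is_derive_cst (1 : R) x (1 : R)).
  by rewrite -[LHS](@derive_val _ _ _ _ _ _ _ (dS x)) (@derive_val _ _ _ _ _ _ _ d1).
have cns : {within `[0, 1], continuous (fun x => `|s x|)}.
  apply: continuous_subspaceT => x; apply: continuous_comp; first exact: cs.
  exact: norm_continuous.
have [c _ cM] := EVT_max ler01 cns.
exists S, s, `|s c|; split => //; split => // x.
have [x01|/sout ->] := boolP (0 <= x <= 1); last by rewrite normr0.
by apply: cM; rewrite in_itv.
Unshelve. all: by end_near. Qed.

(** The weight is the derivative of a rescaled step, so it has integral 1 on its support
    [[p, p + dl]], and [z] can be moved under the integral. The weight is at most [M / dl] on a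
    support of length [dl]; the factor [M] replaces 1 because [s] is not assumed nonnegative. *)
Lemma mollify_le S s f (p e z M a b dl : R) :
  (forall x : R, is_derive x (1 : R) S (s x)) -> continuous s ->
  S 0 = 0 -> S 1 = 1 ->
  (forall x, `|s x| <= M) -> (forall x, ~~ (0 <= x <= 1) -> s x = 0) ->
  0 < dl -> a < p -> p + dl < b -> {within `[a, b], continuous f} ->
  (forall t, p <= t <= p + dl -> `|f t - z| <= e) ->
  `|\int[mu]_(t in `]a, b[)
     (f t * (dl^-1 * s (dl^-1 * t + - (dl^-1 * p)))) - z| <= M * e.
Proof.
move=> dS cs S0 S1 sM sout dl0 ap pb cf fz.
pose u t := dl^-1 * t + - (dl^-1 * p).
pose sg t := dl^-1 * s (u t).
have du (t : R) : is_derive t (1 : R) u dl^-1.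
  by apply: is_derive_eq; rewrite scaler1 subr0.
have csg : continuous sg.
  move=> t; apply: cvgM; first exact: cvg_cst.
  apply: (@continuous_comp _ _ _ u s); last exact: cs.
  exact: (@is_derive_continuous _ (cst dl^-1)).
have dG (t : R) : is_derive t (1 : R) (S \o u) (sg t).
  by rewrite /sg mulrC; apply: is_derive1_comp.
have intsg : \int[mu]_(t in `[p, p + dl]) sg t = 1.
  rewrite /Rintegral (@continuous_FTC2 _ sg (S \o u)).
  - rewrite /= /u -mulrN -!mulrDr subrr mulr0 S0 addrAC subrr add0r mulVf ?gt_eqF//.
    by rewrite S1 subr0.
  - by rewrite ltrDl.
  - exact: continuous_subspaceT.
  - have cG t : {for t, continuous (S \o u)} by exact: is_derive_continuous (dG t).
    split; [by move=> t _; case: (dG t)|apply: cvg_at_right_filter; exact: cG|].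
    by apply: cvg_at_left_filter; exact: cG.
  - by move=> t _; rewrite derive1E; exact: (@derive_val _ _ _ _ _ _ _ (dG t)).
have sub : `[p, p + dl] `<=` `[a, b].
  by apply: subset_itvScc; rewrite bnd_simp ltW.
have cfP : {within `[p, p + dl], continuous f} by apply: continuous_subspaceW cf.
have csgP : {within `[p, p + dl], continuous sg} by exact: continuous_subspaceT.
have cp : compact `[p, p + dl] by exact: segment_compact.
have isg : mu.-integrable `[p, p + dl] (EFin \o sg).
  exact: continuous_compact_integrable.
have ifsg : mu.-integrable `[p, p + dl] (EFin \o (fun t => f t * sg t)).
  by apply: continuous_compact_integrable => //; exact: within_continuousM.
rewrite (_ : \int[mu]_(t in _) _ = \int[mu]_(t in `[p, p + dl]) (f t * sg t)); last first.
  rewrite -[in RHS](@setIidr _ `]a, b[ `[p, p + dl]); last first.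
    by move=> t /=; rewrite !in_itv/= => /andP[pt tp]; apply/andP; split; lra.
  rewrite Rintegral_mkcondr; apply: eq_Rintegral => t _.
  rewrite patchE; case: ifPn => //; rewrite notin_setE/= in_itv/= => tp.
  rewrite sout ?mulr0//; apply: contra_notN tp.
  rewrite -mulrBr (mulrC _ (t - p)) ler_pdivlMr// ler_pdivrMr// mul0r mul1r.
  by move=> ?; lra.
have -> : z = \int[mu]_(t in `[p, p + dl]) (z * sg t).
  by rewrite RintegralZl// intsg mulr1.
have izsg : mu.-integrable `[p, p + dl] (EFin \o (fun t => z * sg t)).
  apply: continuous_compact_integrable => //; apply: within_continuousM => //.
  exact: within_continuous_cst.
rewrite -RintegralB// (le_trans (le_normr_Rintegral _ _))//.
  exact: integrable_EFinB.
have -> : M * e = \int[mu]_(t in `[p, p + dl]) (e * (dl^-1 * M)).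
  rewrite Rintegral_itvcc_cst ?lerDl ?ltW// [p + dl]addrC addrK.
  by field; rewrite gt_eqF.
apply: le_Rintegral => //.
- apply: continuous_compact_integrable => //; apply: within_continuous_norm.
  apply: within_continuousB; first exact: within_continuousM.
  by apply: within_continuousM => //; exact: within_continuous_cst.
- apply: continuous_compact_integrable => //; exact: within_continuous_cst.
- move=> t; rewrite /= in_itv/= => tp.
  rewrite -mulrBl normrM ler_pM// ?fz//.
  by rewrite normrM gtr0_norm ?invr_gt0// ler_pM2l ?invr_gt0.
Qed.

End Mollifier.

(** * The fundamental theorem of calculus for weak derivatives *)

Section WeakDerivative.
Context {R : realType}.
Notation mu := (@lebesgue_measure R).
Implicit Types (f g h S s : R -> R) (a b c d x y t : R).

(* 0 outside [x + dl, y - dl] and 1 on [x + 2 dl, y - 2 dl]: the support stays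
   in the open interval even for x = a and y = b. *)
Definition plateau S x y dl t : R :=
  S (dl^-1 * t + - (dl^-1 * (x + dl))) - S (dl^-1 * t + - (dl^-1 * (y - 2 * dl))).

Lemma plateau_out S x y dl t : (forall x, x <= 0 -> S x = 0) ->
  (forall x, 1 <= x -> S x = 1) -> 0 < dl -> 4 * dl <= y - x ->
  ~~ (x + dl <= t <= y - dl) -> plateau S x y dl t = 0.
Proof.
move=> S0 S1 dl0 dxy; rewrite negb_and -!ltNge /plateau -!mulrBr => /orP[tx|ty].
  by rewrite !S0 ?subrr// pmulr_rle0 ?invr_gt0//; lra.
by rewrite !S1 ?subrr// mulrC ler_pdivlMr//; lra.
Qed.

Lemma plateau_in S x y dl t : (forall x, x <= 0 -> S x = 0) ->
  (forall x, 1 <= x -> S x = 1) -> 0 < dl ->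
  x + 2 * dl <= t <= y - 2 * dl -> plateau S x y dl t = 1.
Proof.
move=> S0 S1 dl0 /andP[xt ty]; rewrite /plateau -!mulrBr.
rewrite S1 ?S0 ?subr0//; first by rewrite pmulr_rle0 ?invr_gt0//; lra.
by rewrite mulrC ler_pdivlMr//; lra.
Qed.

Lemma plateau_smooth S x y dl : smooth S -> smooth (plateau S x y dl).
Proof.
move=> sS n; rewrite (_ : plateau S x y dl =
  (fun t => S (dl^-1 * t + - (dl^-1 * (x + dl)))) \+
  (cst (-1) \* (fun t => S (dl^-1 * t + - (dl^-1 * (y - 2 * dl)))))).
  apply: CnD; first exact: Cn_affine.
  by apply: CnM; [exact: Cn_cst|exact: Cn_affine].
by apply/funext => t; rewrite /plateau /= mulN1r.
Qed.

Lemma plateau_test S a b x y dl : smooth S -> (forall x, x <= 0 -> S x = 0) ->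
  (forall x, 1 <= x -> S x = 1) -> 0 < dl -> 4 * dl <= y - x ->
  a <= x -> y <= b -> test_function a b (plateau S x y dl).
Proof.
move=> sS S0 S1 dl0 dxy ax yb.
have sub : closure [set t | plateau S x y dl t != 0] `<=` `[x + dl, y - dl].
  rewrite [X in _ `<=` X](closure_id _).1; last exact: itv_closed.
  apply: closureS => t /=; rewrite in_itv/=; apply: contraNT => ?.
  by rewrite plateau_out.
split.
- by apply: smooth_derivable; exact: plateau_smooth.
- apply: (subclosed_compact _ _ sub); first exact: closed_closure.
  exact: segment_compact.
- by apply: (subset_trans sub) => t; rewrite /= !in_itv/= => /andP[? ?]; apply/andP; split; lra.
Qed.

Lemma plateau_derive S s x y dl t : (forall x : R, is_derive x (1 : R) S (s x)) ->
  derive1 (plateau S x y dl) t =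
  dl^-1 * s (dl^-1 * t + - (dl^-1 * (x + dl))) -
  dl^-1 * s (dl^-1 * t + - (dl^-1 * (y - 2 * dl))).
Proof.
move=> dS.
have d1 (p : R) : is_derive t (1 : R) (fun t => S (dl^-1 * t + - (dl^-1 * p)))
    (dl^-1 * s (dl^-1 * t + - (dl^-1 * p))).
  rewrite [X in is_derive _ _ _ X]mulrC.
  apply: (@is_derive1_comp _ S (fun t => dl^-1 * t + - (dl^-1 * p))).
  by apply: is_derive_eq; rewrite scaler1 subr0.
by rewrite derive1E; exact: (@derive_val _ _ _ _ _ _ _ (is_deriveB (d1 _) (d1 _))).
Qed.

Lemma plateau_derive_cvg S s f (M : R) a b x y (dl : R^nat) : continuous s ->
  (forall x : R, is_derive x (1 : R) S (s x)) -> (forall x, `|s x| <= M) ->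
  (forall x, ~~ (0 <= x <= 1) -> s x = 0) -> S 0 = 0 -> S 1 = 1 ->
  (forall n, 0 < dl n) -> (forall n, 4 * dl n <= y - x) ->
  dl n @[n --> \oo] --> (0 : R) ->
  {within `[a, b], continuous f} -> a <= x -> x < y -> y <= b ->
  \int[mu]_(t in `]a, b[) (f t * derive1 (plateau S x y (dl n)) t) @[n --> \oo]
    --> f x - f y.
Proof.
move=> cs dS sM sout S0 S1 dl0 dl4 dlcvg cf ax xy yb.
have M0 : 0 <= M by apply: le_trans (sM 0).
(* Two mollifier errors of size at most [M * e'] have to add up to at most [e]; the [+ 1] keeps the
   divisor positive even for [M = 0]. *)
apply/cvgrPdist_le => e e0; pose e' := e / (2 * (M + 1)).
have e'0 : 0 < e' by rewrite divr_gt0// mulr_gt0// ltr_wpDl.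
have axy : `[x, y] `<=` `[a, b] by apply: subset_itvScc; rewrite bnd_simp.
have [|r1 r10 H1] := within_continuous_ex (x := x) cf _ e'0.
  by apply: axy; rewrite /= in_itv/= lexx ltW.
have [|r2 r20 H2] := within_continuous_ex (x := y) cf _ e'0.
  by apply: axy; rewrite /= in_itv/= lexx ltW.
(* The factor 2 is due to the mollifier supports [[x + dl, x + 2 dl]] and [[y - 2 dl, y - dl]],
   which reach up to [2 dl] away from [x] and [y]. *)
have dsmall (r : R) : 0 < r -> \forall n \near \oo, 2 * dl n < r.
  move=> r0; have : 0 < r / 2 by rewrite divr_gt0.
  move=> /(cvgr0_norm_lt _ dlcvg); apply: filterS => n.
  by rewrite gtr0_norm//; lra.
near=> n.
have n1 : 2 * dl n < r1 by near: n; exact: dsmall.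
have n2 : 2 * dl n < r2 by near: n; exact: dsmall.
have dn0 := dl0 n; have dn4 := dl4 n.
pose A p t := (dl n)^-1 * s ((dl n)^-1 * t + - ((dl n)^-1 * p)).
have cA p : {within `[a, b], continuous (A p)}.
  apply: within_continuousM; first exact: within_continuous_cst.
  apply: continuous_subspaceT => t.
  apply: (@continuous_comp _ _ _ (fun t => (dl n)^-1 * t + - ((dl n)^-1 * p)) s);
    last exact: cs.
  apply: (@is_derive_continuous _ _ (cst (dl n)^-1)).
  by apply: is_derive_eq; rewrite scaler1 subr0.
have ifA p : mu.-integrable `]a, b[ (EFin \o (fun t => f t * A p t)).
  have : mu.-integrable `[a, b] (EFin \o (fun t => f t * A p t)).
    apply: continuous_compact_integrable; first exact: segment_compact.
    exact: within_continuousM.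
  by apply: integrableS => //; exact: subset_itv_oo_cc.
rewrite (_ : \int[mu]_(t in _) _ = \int[mu]_(t in `]a, b[) (f t * A (x + dl n) t)
    - \int[mu]_(t in `]a, b[) (f t * A (y - 2 * dl n) t)); last first.
  rewrite -RintegralB//; apply: eq_Rintegral => t _.
  by rewrite (plateau_derive _ _ _ _ dS) mulrBr.
have -> : e = (M + 1) * e' + (M + 1) * e'.
  by rewrite /e'; field; rewrite gt_eqF// ltr_wpDl.
have Me : M * e' <= (M + 1) * e' by rewrite ler_pM2r// lerDl.
have t1 := mollify_le dS cs S0 S1 sM sout dn0.
have -> (I1 I2 : R) : f x - f y - (I1 - I2) = - (I1 - f x) + (I2 - f y) by lra.
rewrite (le_trans (ler_normD _ _))// normrN lerD// (le_trans _ Me)// t1//; try lra.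
  move=> t /andP[t3 t4]; apply: H1; first by apply: axy; rewrite /= in_itv/=; lra.
  by rewrite ger0_norm; lra.
move=> t /andP[t3 t4]; apply: H2; first by apply: axy; rewrite /= in_itv/=; lra.
by rewrite ler0_norm; lra.
Unshelve. all: by end_near. Qed.

(** Dominated convergence under [|h|]: at every point the plateaus are eventually equal to the
    indicator of the open interval, and the endpoints of [[x, y]] are negligible. *)
Lemma plateau_cvg S h a b x y (dl : R^nat) : smooth S ->
  (forall x, x <= 0 -> S x = 0) -> (forall x, 1 <= x -> S x = 1) ->
  (forall x, 0 <= S x <= 1) ->
  (forall n, 0 < dl n) -> (forall n, 4 * dl n <= y - x) ->
  dl n @[n --> \oo] --> (0 : R) ->
  measurable_fun setT h -> mu.-integrable setT (EFin \o h) ->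
  a <= x -> x < y -> y <= b ->
  \int[mu]_(t in `]a, b[) (h t * plateau S x y (dl n) t) @[n --> \oo] -->
  \int[mu]_(t in `[x, y]) h t.
Proof.
move=> sS S0 S1 S01 dl0 dl4 dlcvg mh ih ax xy yb.
pose phi n := plateau S x y (dl n).
have sub : `]x, y[ `<=` `]a, b[ by apply: subset_itvSoo; rewrite bnd_simp.
have mI : measurable (`]a, b[ : set (measurableTypeR R)) by [].
have ihI : mu.-integrable `]a, b[ (EFin \o h).
  exact: integrableS ih.
have mphi n : measurable_fun setT (phi n).
  apply: continuous_measurable_fun => t.
  apply: (@is_derive_continuous _ _ (fun t => 'D_1 (phi n) t)).
  apply: derivableP.
  exact: (Cn_derivable (plateau_smooth x y (dl n) sS 0)).
have phi1 n t : `|phi n t| <= 1.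
  rewrite /phi /plateau; set u := S _; set v := S _.
  have /andP[? ?] : 0 <= u <= 1 by exact: S01.
  have /andP[? ?] : 0 <= v <= 1 by exact: S01.
  by rewrite ler_norml; lra.
have [||||| _ _] := @dominated_convergence _ _ _ mu _ mI
  (fun n => EFin \o (fun t => h t * phi n t)) (EFin \o h \_ `]x, y[)
  (EFin \o (fun t => `|h t|)).
- move=> n; apply/measurable_EFinP; apply: measurable_funTS.
  by apply: measurable_funM; [exact: mh|exact: mphi].
- apply/measurable_EFinP; apply: measurable_funTS.
  by apply/(measurable_restrictT _ _).1 => //; exact: measurable_funTS.
- apply: aeW => t _; apply: cvg_near_cst; rewrite /= patchE.
  have [txy|txy] := boolP (t \in `]x, y[%classic).
    rewrite inE/= in_itv/= in txy; have /andP[xt ty] := txy.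
    near=> n; congr EFin; rewrite /phi plateau_in ?mulr1//.
    have n1 : `|dl n| < (t - x) / 2.
      by near: n; apply: cvgr0_norm_lt => //; rewrite divr_gt0// subr_gt0.
    have n2 : `|dl n| < (y - t) / 2.
      by near: n; apply: cvgr0_norm_lt => //; rewrite divr_gt0// subr_gt0.
    rewrite !gtr0_norm// in n1 n2; clear -n1 n2; lra.
  rewrite notin_setE/= in_itv/= in txy.
  near=> n; congr EFin; rewrite /phi plateau_out ?mulr0//.
  apply: contra_notN txy; have := dl0 n; clear -x; lra.
- exact: integrable_norm.
- by apply: aeW => t n _; rewrite /= lee_fin normrM ler_piMr.
have iphi : mu.-integrable `]a, b[ (EFin \o h \_ `]x, y[).
  rewrite -restrict_EFin; apply/integrable_restrict => //.
  by rewrite setIidr//; exact: integrableS ih.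
move=> c3; have -> : \int[mu]_(t in `[x, y]) h t =
    \int[mu]_(t in `]a, b[) (h \_ `]x, y[) t.
  rewrite -Rintegral_mkcondr setIidr// -Rintegral_itv_obnd_cbnd; last first.
    exact: integrableS ih.
  by rewrite -Rintegral_itv_bndo_bndc//; exact: integrableS ih.
apply: fine_cvg; rewrite fineK//; exact: integrable_fin_num.
Unshelve. all: by end_near. Qed.

Lemma weak_derivative_FTC a b f df x y :
  {within `[a, b], continuous f} -> L2_on a b df -> weak_derivative a b f df ->
  a <= x -> x < y -> y <= b ->
  f y - f x = \int[mu]_(t in `[x, y]) zero_ext `]a, b[ df t.
Proof.
move=> cf df2 wdf ax xy yb.
have [S [s [M [[sS dS cs sM sout] [S0 S1 S01]]]]] := @smooth_step_derive R.
have M0 : 0 <= M by apply: le_trans (sM 0).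
(* A plateau needs a margin and a ramp of length [dl n] at either end; the divisor 4 makes them fit
   already for [n = 0]. *)
pose dl n := (y - x) / 4 * (n.+1%:R)^-1 : R.
have dl0 n : 0 < dl n by rewrite mulr_gt0 ?invr_gt0// divr_gt0// subr_gt0.
have dl4 n : 4 * dl n <= y - x.
  rewrite /dl mulrA [4 * _]mulrC divfK// ger_pMr ?subr_gt0// invf_le1 ?ltr0n//.
  by rewrite ler1n.
have dlcvg : dl n @[n --> \oo] --> (0 : R).
  by rewrite -(mulr0 ((y - x) / 4)); apply: cvgM; [exact: cvg_cst|exact: cvg_harmonic].
pose h := zero_ext `]a, b[ df.
have mh : measurable_fun setT h := L2_on_measurable df2.
have ih : mu.-integrable setT (EFin \o h) := L2_on_integrable df2.
pose phi n := plateau S x y (dl n).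
have cvg1 : \int[mu]_(t in `]a, b[) (f t * derive1 (phi n) t) @[n --> \oo] --> f x - f y.
  by apply: (plateau_derive_cvg (s := s) (M := M)) => //; [exact: S0|exact: S1].
have cvg2 : \int[mu]_(t in `]a, b[) (df t * phi n t) @[n --> \oo] -->
    \int[mu]_(t in `[x, y]) h t.
  rewrite (_ : (fun n => _) = (fun n => \int[mu]_(t in `]a, b[) (h t * phi n t))).
    exact: plateau_cvg.
  apply/funext => n; apply: eq_Rintegral => t tab.
  by rewrite /h /zero_ext patchE tab.
have : \int[mu]_(t in `]a, b[) (f t * derive1 (phi n) t) @[n --> \oo] -->
    - \int[mu]_(t in `[x, y]) h t.
  rewrite (_ : (fun n => _) = (fun n => - \int[mu]_(t in `]a, b[) (df t * phi n t))).
    exact: cvgN.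
  by apply/funext => n; apply: wdf; exact: plateau_test.
move=> /(cvg_unique _ cvg1) => /(_ (@Rhausdorff R)).
by move=> e; rewrite -[RHS]opprK -e opprB.
Qed.

End WeakDerivative.

(** * Integration by parts *)

Section IntegrationByParts.
Context {R : realType}.
Notation mu := (@lebesgue_measure R).
Implicit Types (f g h k : R -> R) (a b c d x y t : R).

Lemma within_continuous_bounded c d k : {within `[c, d], continuous k} ->
  exists2 M : R, 0 <= M & forall t, c <= t <= d -> `|k t| <= M.
Proof.
move=> ck; have [cd|dc] := leP c d; last first.
  by exists 0 => // t /andP[ct td]; have := lt_le_trans dc (le_trans ct td); rewrite ltxx.
have [m _ mM] := EVT_max cd (within_continuous_norm ck).
by exists `|k m| => // t tcd; apply: mM; rewrite in_itv.
Qed.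

Lemma integrable_within_continuousM c d h k :
  mu.-integrable `[c, d] (EFin \o h) -> {within `[c, d], continuous k} ->
  mu.-integrable `[c, d] (EFin \o (fun t => h t * k t)).
Proof.
move=> ih ck; have [M M0 kM] := within_continuous_bounded ck.
have mk : measurable_fun (`[c, d] : set (measurableTypeR R)) k.
  exact: subspace_continuous_measurable_fun.
have bk : [bounded k t | t in `[c, d]].
  exists M; split; first exact: num_real.
  by move=> M' MM' t; rewrite /= in_itv/= => /kM /le_trans; apply; exact: ltW.
by refine (integrableMl _ ih mk bk).
Qed.

Lemma Rintegral_itvcc_split g c x d : mu.-integrable `[c, d] (EFin \o g) ->
  c <= x -> x <= d ->
  \int[mu]_(t in `[c, d]) g t =
  \int[mu]_(t in `[c, x]) g t + \int[mu]_(t in `[x, d]) g t.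
Proof.
move=> ig cx xd.
have := @Rintegral_itvB R g (BLeft c) (BRight d) x ig.
rewrite !bnd_simp => /(_ cx xd) H.
rewrite -(Rintegral_itv_obnd_cbnd (r := x)); last first.
  by apply: integrableS ig => //; apply: subset_itv; rewrite bnd_simp.
by rewrite -H addrC subrK.
Qed.

Lemma integrable_itvccS g c d x y : mu.-integrable `[c, d] (EFin \o g) ->
  c <= x -> y <= d -> mu.-integrable `[x, y] (EFin \o g).
Proof.
by move=> ig cx yd; apply: integrableS ig => //; apply: subset_itv; rewrite bnd_simp.
Qed.

Lemma le_halfD_sqr (l u : R) : 0 < l -> u <= 2^-1 * (l * u ^+ 2 + l^-1).
Proof.
move=> l0; rewrite -subr_ge0.
have -> : 2^-1 * (l * u ^+ 2 + l^-1) - u = (l * u - 1) ^+ 2 / (2 * l).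
  by field; rewrite gt_eqF.
by rewrite divr_ge0 ?sqr_ge0// mulr_ge0// ltW.
Qed.

(* AM-GM with the weight l = sqrt (y - x). *)
Lemma Rintegral_norm_sqrt h x y :
  mu.-integrable setT (EFin \o h) ->
  mu.-integrable setT (EFin \o (fun t => h t ^+ 2)) -> x < y ->
  \int[mu]_(t in `[x, y]) `|h t| <=
    (\int[mu]_t (h t ^+ 2) + 1) / 2 * Num.sqrt (y - x).
Proof.
move=> ih ih2 xy.
set l := Num.sqrt (y - x); set H := \int[mu]_t _.
have l0 : 0 < l by rewrite sqrtr_gt0 subr_gt0.
have yxE : y - x = l ^+ 2 by rewrite sqr_sqrtr// subr_ge0 ltW.
have ih2' : mu.-integrable `[x, y] (EFin \o (fun t => h t ^+ 2)) by exact: integrableS ih2.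
have icst : mu.-integrable `[x, y] (EFin \o (fun=> l^-1)).
  apply: continuous_compact_integrable; first exact: segment_compact.
  exact: within_continuous_cst.
have ilh2 : mu.-integrable `[x, y] (EFin \o (fun t => l * h t ^+ 2)).
  by apply: (integrableZl _ _ ih2').
have isum := integrable_EFinD (measurable_itv _) ilh2 icst.
have isum2 : mu.-integrable `[x, y] (EFin \o (fun t => 2^-1 * (l * h t ^+ 2 + l^-1))).
  exact: (integrableZl _ _ isum).
apply: (@le_trans _ _ (\int[mu]_(t in `[x, y]) (2^-1 * (l * h t ^+ 2 + l^-1)))).
  apply: le_Rintegral => //; first by apply: integrable_norm; exact: integrableS ih.
  move=> t _; rewrite -[h t ^+ 2]real_normK ?num_real//.
  exact: le_halfD_sqr.
rewrite RintegralZl// RintegralD// RintegralZl// (Rintegral_itvcc_cst _ (ltW xy)).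
have : \int[mu]_(t in `[x, y]) (h t ^+ 2) <= H.
  rewrite /H /Rintegral fine_le//; [exact: integrable_fin_num|exact: integrable_fin_num|].
  apply: ge0_subset_integral => //; first exact: measurable_int ih2.
  by move=> t _; rewrite lee_fin sqr_ge0.
set H' := \int[mu]_(t in _) _ => H'H.
have -> : 2^-1 * (l * H' + l^-1 * (y - x)) = (H' + 1) / 2 * l.
  by rewrite yxE; field; rewrite gt_eqF.
by rewrite ler_pM2r// ler_pM2r// lerD2r.
Qed.

(* Halving [x, y] n times gains a factor sqrt(1/2)^n in the bound. *)
Lemma cst_of_le_sqrt g (K c d : R) : c <= d ->
  (forall x y, c <= x -> x <= y -> y <= d ->
    `|g y - g x| <= K * ((y - x) * Num.sqrt (y - x))) -> g d = g c.
Proof.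
move=> cd gK; pose r : R := Num.sqrt 2^-1.
have r1 : `|r| < 1.
  by rewrite ger0_norm ?sqrtr_ge0// -sqrtr1 ltr_sqrt// invf_lt1 ?ltr1n.
have grn n x y : c <= x -> x <= y -> y <= d ->
    `|g y - g x| <= K * ((y - x) * Num.sqrt (y - x)) * r ^+ n.
  elim: n x y => [|n IH] x y cx xy yd; first by rewrite mulr1 gK.
  pose m := (x + y) / 2.
  have -> : g y - g x = (g y - g m) + (g m - g x) by rewrite subrKA.
  rewrite (le_trans (ler_normD _ _))//.
  have := IH m y; have := IH x m.
  have -> : y - m = (y - x) / 2 by rewrite /m; lra.
  have -> : m - x = (y - x) / 2 by rewrite /m; lra.
  rewrite sqrtrM ?subr_ge0// -/r exprS => H1 H2.
  have -> : K * ((y - x) * Num.sqrt (y - x)) * (r * r ^+ n) =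
    K * ((y - x) / 2 * (Num.sqrt (y - x) * r)) * r ^+ n +
    K * ((y - x) / 2 * (Num.sqrt (y - x) * r)) * r ^+ n by field.
  by rewrite lerD ?H1 ?H2// /m; lra.
apply/eqP; rewrite -subr_eq0 -normr_le0.
have : K * ((d - c) * Num.sqrt (d - c)) * r ^+ n @[n --> \oo] --> (0 : R).
  rewrite -[X in _ --> X](mulr0 (K * ((d - c) * Num.sqrt (d - c)))).
  by apply: cvgM; [exact: cvg_cst|exact: cvg_expr].
move=> H; rewrite -(cvg_lim _ H)//; apply: limr_ge; first by apply/cvg_ex; eexists; exact: H.
by apply: nearW => n; exact: grn.
Qed.

End IntegrationByParts.

(** * Integration by parts against an absolutely continuous function *)

Section AbsolutelyContinuousIBP.
Context {R : realType}.
Notation mu := (@lebesgue_measure R).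
Implicit Types (f g h k : R -> R) (a b c d x y t : R).

Lemma within_derive_FTC2 (K : R -> R) k c d : c <= d ->
  (forall x : R, c <= x <= d -> is_derive x (1 : R) K (k x)) ->
  {within `[c, d], continuous k} ->
  \int[mu]_(t in `[c, d]) k t = K d - K c.
Proof.
rewrite le_eqVlt => /predU1P[<- _ _|cd dK ck].
  by rewrite set_itv1 Rintegral_set1 subrr.
have cK x : c <= x <= d -> {for x, continuous K}.
  by move=> xcd; exact: is_derive_continuous (dK _ xcd).
rewrite /Rintegral (@continuous_FTC2 _ k K)//.
  split.
  - by move=> x; rewrite in_itv/= => /andP[cx xd]; case: (dK x _) => //; rewrite !ltW.
  - by apply: cvg_at_right_filter; apply: cK; rewrite lexx ltW.
  - by apply: cvg_at_left_filter; apply: cK; rewrite lexx ltW.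
move=> x; rewrite in_itv/= => /andP[cx xd]; rewrite derive1E.
by apply: (@derive_val _ _ _ _ _ _ _ (dK x _)); rewrite !ltW.
Qed.

Variables (h f K k : R -> R) (c d : R).
Hypotheses (ih : mu.-integrable setT (EFin \o h))
  (ih2 : mu.-integrable setT (EFin \o (fun t => h t ^+ 2)))
  (fh : forall x y, c <= x -> x <= y -> y <= d ->
    f y - f x = \int[mu]_(t in `[x, y]) h t)
  (cf : {within `[c, d], continuous f})
  (dK : forall x : R, c <= x <= d -> is_derive x (1 : R) K (k x))
  (ck : {within `[c, d], continuous k}).

Let ihS (x y : R) : mu.-integrable `[x, y] (EFin \o h).
Proof. exact: integrableS ih. Qed.

Let cK : {within `[c, d], continuous K}.
Proof.
apply: derivable_within_continuous => x; rewrite in_itv/= => xcd.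
by case: (dK xcd).
Qed.

Let subS x y : c <= x -> y <= d -> `[x, y] `<=` `[c, d].
Proof. by move=> cx yd; apply: subset_itv; rewrite bnd_simp. Qed.

Let KE x y : c <= x -> x <= y -> y <= d ->
  K y - K x = \int[mu]_(t in `[x, y]) k t.
Proof.
move=> cx xy yd; apply/esym/within_derive_FTC2 => //.
  by move=> t /andP[xt ty]; apply: dK; rewrite (le_trans cx xt) (le_trans ty yd).
exact: continuous_subspaceW (subS cx yd) ck.
Qed.

(** As [f y - f x] and [K y - K x] are integrals of [h] and [k], the remainder is the integral of
    [h t * (K y - K t)] plus that of [(f x - f t) * k t]. In the first, [K] varies by at most
    [M * (y - x)] while [|h|] has integral O(sqrt (y - x)); in the second, [f] varies by O(sqrt (y -
    x)) while [k] is bounded over a length [y - x]. *)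
Let ibp_remainder M x y : (forall t, c <= t <= d -> `|k t| <= M) -> 0 <= M ->
  c <= x -> x < y -> y <= d ->
  `|f y * K y - f x * K x - \int[mu]_(t in `[x, y]) (f t * k t) -
    \int[mu]_(t in `[x, y]) (h t * K t)| <=
  M * (\int[mu]_t (h t ^+ 2) + 1) * ((y - x) * Num.sqrt (y - x)).
Proof.
move=> kM M0 cx xy yd; have xyW := ltW xy.
have cfS : {within `[x, y], continuous f} by exact: continuous_subspaceW (subS cx yd) cf.
have ckS : {within `[x, y], continuous k} by exact: continuous_subspaceW (subS cx yd) ck.
have cKS : {within `[x, y], continuous K} by exact: continuous_subspaceW (subS cx yd) cK.
have compS : compact `[x, y] by exact: segment_compact.
have ihK : mu.-integrable `[x, y] (EFin \o (fun t => h t * K t)).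
  exact: integrable_within_continuousM.
have ifk : mu.-integrable `[x, y] (EFin \o (fun t => f t * k t)).
  by apply: continuous_compact_integrable => //; exact: within_continuousM.
have ik : mu.-integrable `[x, y] (EFin \o k) by exact: continuous_compact_integrable.
set C := (\int[mu]_t (h t ^+ 2) + 1) / 2.
set sq := Num.sqrt (y - x).
have sq0 : 0 <= sq by exact: sqrtr_ge0.
have C0 : 0 <= C.
  by rewrite divr_ge0// addr_ge0//; apply: Rintegral_ge0 => t _; exact: sqr_ge0.
have ihE : \int[mu]_(t in `[x, y]) (h t * (K y - K t)) =
    (f y - f x) * K y - \int[mu]_(t in `[x, y]) (h t * K t).
  rewrite (fh cx xyW yd) -RintegralZr// -RintegralB//; last first.
    by apply: (integrableZr _ (K y) (ihS _ _)).
  by apply: eq_Rintegral => t _; rewrite mulrBr.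
have ikE : \int[mu]_(t in `[x, y]) ((f x - f t) * k t) =
    f x * (K y - K x) - \int[mu]_(t in `[x, y]) (f t * k t).
  rewrite (KE cx xyW yd) -RintegralZl// -RintegralB//; last first.
    by apply: (integrableZl _ (f x) ik).
  by apply: eq_Rintegral => t _; rewrite mulrBl.
have -> : f y * K y - f x * K x - \int[mu]_(t in `[x, y]) (f t * k t) -
    \int[mu]_(t in `[x, y]) (h t * K t) =
    \int[mu]_(t in `[x, y]) (h t * (K y - K t)) +
    \int[mu]_(t in `[x, y]) ((f x - f t) * k t).
  by rewrite ihE ikE; ring.
have -> : M * (\int[mu]_t (h t ^+ 2) + 1) * ((y - x) * sq) =
    C * sq * (M * (y - x)) + C * sq * M * (y - x) by rewrite /C; field.
have hsq z t : x <= z -> z < t -> t <= y -> \int[mu]_(t in `[z, t]) `|h t| <= C * sq.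
  move=> xz zt ty; rewrite (le_trans (Rintegral_norm_sqrt ih ih2 zt))//.
  by rewrite ler_wpM2l// ler_wsqrtr// lerB.
have inh z t : mu.-integrable `[z, t] (EFin \o (fun u => `|h u|)).
  by apply: integrable_norm; exact: ihS.
rewrite (le_trans (ler_normD _ _))// lerD//.
  rewrite (le_trans (le_normr_Rintegral _ _))//.
    apply: (integrable_within_continuousM (ihS _ _)).
    by apply: within_continuousB => //; exact: within_continuous_cst.
  apply: (@le_trans _ _ (\int[mu]_(t in `[x, y]) (`|h t| * (M * (y - x))))).
    apply: le_Rintegral => //.
    + apply: integrable_norm; apply: (integrable_within_continuousM (ihS _ _)).
      by apply: within_continuousB => //; exact: within_continuous_cst.
    + by apply: (integrableZr _ (M * (y - x)) (inh _ _)).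
    + move=> t; rewrite /= in_itv/= => /andP[xt ty]; rewrite normrM ler_wpM2l//.
      rewrite (KE (le_trans cx xt) ty yd).
      have ikt : mu.-integrable `[t, y] (EFin \o k) by exact: integrable_itvccS ik _ _.
      rewrite (le_trans (le_normr_Rintegral _ _))//.
      apply: (@le_trans _ _ (\int[mu]_(_ in `[t, y]) M)).
        apply: le_Rintegral => //; first exact: integrable_norm.
          apply: continuous_compact_integrable; first exact: segment_compact.
          exact: within_continuous_cst.
        move=> u; rewrite /= in_itv/= => /andP[tu uy]; apply: kM.
        by rewrite (le_trans cx (le_trans xt tu)) (le_trans uy yd).
      by rewrite Rintegral_itvcc_cst// ler_wpM2l// lerB.
  rewrite RintegralZr// ler_wpM2r//; first by rewrite mulr_ge0// subr_ge0.
  exact: hsq.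
rewrite (le_trans (le_normr_Rintegral _ _))//.
  apply: continuous_compact_integrable => //; apply: within_continuousM => //.
  by apply: within_continuousB => //; exact: within_continuous_cst.
apply: (@le_trans _ _ (\int[mu]_(t in `[x, y]) (C * sq * M))).
  apply: le_Rintegral => //.
  + apply: continuous_compact_integrable => //; apply: within_continuous_norm.
    apply: within_continuousM => //.
    by apply: within_continuousB => //; exact: within_continuous_cst.
  + by apply: continuous_compact_integrable => //; exact: within_continuous_cst.
  + move=> t; rewrite /= in_itv/= => /andP[xt ty]; rewrite normrM ler_pM//; last first.
      by apply: kM; rewrite (le_trans cx xt) (le_trans ty yd).
    rewrite distrC (fh cx xt (le_trans ty yd)) (le_trans (le_normr_Rintegral _ _))//.
    move: xt; rewrite le_eqVlt => /predU1P[<-|xt]; last exact: hsq.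
    by rewrite set_itv1 Rintegral_set1 mulr_ge0.
by rewrite Rintegral_itvcc_cst.
Qed.

Lemma absolutely_continuous_by_parts : c <= d ->
  \int[mu]_(t in `[c, d]) (f t * k t) =
  f d * K d - f c * K c - \int[mu]_(t in `[c, d]) (h t * K t).
Proof.
move=> cd; have [M M0 kM] := within_continuous_bounded ck.
have ifk : mu.-integrable `[c, d] (EFin \o (fun t => f t * k t)).
  by apply: continuous_compact_integrable; [exact: segment_compact|exact: within_continuousM].
have ihK : mu.-integrable `[c, d] (EFin \o (fun t => h t * K t)).
  exact: integrable_within_continuousM.
(* Up to the constant [f c * K c], [G x] is the defect of the formula on [[c, x]]; its increments
   are the remainders just bounded, so [G] is constant. *)
pose G x := f x * K x - \int[mu]_(t in `[c, x]) (f t * k t) -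
  \int[mu]_(t in `[c, x]) (h t * K t).
have : G d = G c.
  apply: (cst_of_le_sqrt (K := M * (\int[mu]_t (h t ^+ 2) + 1)) cd) => x y cx.
  rewrite le_eqVlt => /predU1P[<- _|xy yd].
    by rewrite !subrr normr0 mul0r mulr0.
  have := ibp_remainder kM M0 cx xy yd; congr (`|_| <= _).
  have ifk' := integrable_itvccS ifk (lexx c) yd.
  have ihK' := integrable_itvccS ihK (lexx c) yd.
  rewrite /G (Rintegral_itvcc_split ifk' cx (ltW xy)).
  by rewrite (Rintegral_itvcc_split ihK' cx (ltW xy)); ring.
rewrite /G set_itv1 !Rintegral_set1 !subr0 => e.
by rewrite -e; ring.
Qed.

End AbsolutelyContinuousIBP.

(** * The logarithmic kernel *)

Section WeakSingularity.
Context {R : realType}.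
Notation mu := (@lebesgue_measure R).
Implicit Types (f g h k : R -> R) (a b c d x y t : R).

(** Monotone convergence carries the uniform bound over to the union; this handles an integrand that
    blows up at an end of the interval. *)
Lemma ge0_integrable_bigcup (F : (set (measurableTypeR R))^nat) g (B : R) :
  (forall n, measurable (F n)) -> nondecreasing_seq F ->
  (forall n, mu.-integrable (F n) (EFin \o g)) -> (forall x, 0 <= g x) ->
  (forall n, \int[mu]_(x in F n) g x <= B) ->
  mu.-integrable (\bigcup_n F n) (EFin \o g).
Proof.
move=> mF ndF iF g0 gB.
have mg n : measurable_fun (F n) (EFin \o g) by exact: measurable_int (iF n).
have mgU : measurable_fun (\bigcup_n F n) (EFin \o g).
  by apply/measurable_fun_bigcup.
apply/integrableP; split => //.
have g0E n x : F n x -> (0 <= (EFin \o g) x)%E by rewrite lee_fin.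
have cvgI := ge0_nondecreasing_set_cvg_integral (mu := mu) ndF mF mg g0E.
under eq_integral do rewrite gee0_abs ?lee_fin//.
apply: (@le_lt_trans _ _ B%:E); last exact: ltry.
rewrite -(cvg_lim _ cvgI)//; apply: lime_le; first by apply/cvg_ex; eexists; exact: cvgI.
apply: nearW => n; rewrite -[leLHS]fineK; first by rewrite lee_fin; exact: gB.
exact: integrable_fin_num.
Qed.

(** Every function is measurable on the singleton of [t], so its value at the singularity is
    irrelevant. *)
Lemma measurable_fun_punctured (D : set (measurableTypeR R)) g t : open D ->
  (forall x, D x -> x != t -> {for x, continuous g}) -> measurable_fun D g.
Proof.
move=> oD cg.
have mt : measurable ([set t] : set (measurableTypeR R)) by [].
have mD : measurable D by exact: open_measurable.
have oDt : open (D `\` [set t]).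
  by rewrite setDE; apply: openI => //; rewrite openC -set_itv1; exact: itv_closed.
rewrite -[D](@setUIDK _ D [set t]).
apply/measurable_funU; [exact: measurableI|exact: measurableD|split].
  by apply: (measurable_funS mt (@subIsetr _ _ _)); exact: measurable_fun_set1.
apply: open_continuous_measurable_fun => // x; rewrite inE => -[Dx /= xt].
by apply: cg => //; exact/eqP.
Qed.

(** Up to a constant, the square of the majorant in [log_kernel_bound]; its integrability makes the
    logarithmic kernel square integrable. *)
Definition isqrt_dist t x : R := (Num.sqrt `|x - t|)^-1.

Lemma isqrt_dist_ge0 t x : 0 <= isqrt_dist t x.
Proof. by rewrite invr_ge0 sqrtr_ge0. Qed.

Lemma isqrt_dist_derive t x : t < x ->
  is_derive x (1 : R) (fun x => 2 * Num.sqrt (x - t)) (isqrt_dist t x).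
Proof.
move=> tx; have xt0 : 0 < x - t by rewrite subr_gt0.
have d1 : is_derive x (1 : R) (fun x => x - t) 1.
  by apply: is_derive_eq; rewrite subr0.
have d2 := @is_derive1_comp _ Num.sqrt (fun x => x - t) _ _ _ (is_derive1_sqrt xt0) d1.
apply: (is_derive_eq (is_deriveZ 2 d2)).
rewrite /isqrt_dist gtr0_norm// mulr1 invfM /GRing.scale/= mulrA divff ?mul1r//.
Qed.

Lemma isqrt_dist_deriveN t x : x < t ->
  is_derive x (1 : R) (fun x => - 2 * Num.sqrt (t - x)) (isqrt_dist t x).
Proof.
move=> xt; have xt0 : 0 < t - x by rewrite subr_gt0.
have d1 : is_derive x (1 : R) (fun x => t - x) (-1).
  by apply: is_derive_eq; rewrite add0r mul1r.
have d2 := @is_derive1_comp _ Num.sqrt (fun x => t - x) _ _ _ (is_derive1_sqrt xt0) d1.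
apply: (is_derive_eq (is_deriveZ (- 2) d2)).
rewrite /isqrt_dist distrC gtr0_norm// mulrN1 invfM /GRing.scale/= mulNr mulrN opprK.
by rewrite mulrA divff ?mul1r//.
Qed.

Lemma isqrt_dist_continuous t x : x != t -> {for x, continuous (isqrt_dist t)}.
Proof.
move=> xt; apply: continuousV.
  by rewrite gt_eqF// sqrtr_gt0 normr_gt0 subr_eq0.
apply: continuous_comp; last exact: sqrt_continuous.
apply: continuous_comp; last exact: norm_continuous.
by apply: continuousB; [exact: cvg_id|exact: cst_continuous].
Qed.

(** The pieces [[t + 1 / (n + 1), d]] exhaust the interval, and the primitive [2 * sqrt (x - t)]
    bounds all their integrals by its value at [d]. *)
Lemma isqrt_dist_integrable_gt t d : mu.-integrable `]t, d] (EFin \o isqrt_dist t).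
Proof.
rewrite itv_open_bnd_bigcup; apply: (@ge0_integrable_bigcup _ _ (2 * Num.sqrt (d - t))) => //.
- apply/nondecreasing_seqP => n; apply/subsetPset; apply: subset_itvr.
  by rewrite bnd_simp lerD2l lef_pV2 ?posrE ?ltr0n// ler_nat.
- move=> n; apply: continuous_compact_integrable; first exact: segment_compact.
  apply: continuous_in_subspaceT => x; rewrite inE/= in_itv/= => /andP[tx _].
  apply: isqrt_dist_continuous; rewrite gt_eqF// (lt_le_trans _ tx)// ltrDl invr_gt0 ltr0n//.
- by move=> x; exact: isqrt_dist_ge0.
- move=> n.
  have n0 : 0 < n.+1%:R^-1 :> R by rewrite invr_gt0.
  have [nd|dn] := leP (t + n.+1%:R^-1) d; last first.
    by rewrite set_itv_ge ?Rintegral_set0 ?mulr_ge0 ?sqrtr_ge0// bnd_simp -ltNge.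
  have dK (x : R) : t + n.+1%:R^-1 <= x <= d ->
      is_derive x (1 : R) (fun x => 2 * Num.sqrt (x - t)) (isqrt_dist t x).
    by move=> /andP[nx _]; apply: isqrt_dist_derive; rewrite (lt_le_trans _ nx)// ltrDl.
  rewrite (within_derive_FTC2 nd dK); first by rewrite gerBl mulr_ge0 ?sqrtr_ge0.
  apply: continuous_in_subspaceT => x; rewrite inE/= in_itv/= => /andP[tx _].
  by apply: isqrt_dist_continuous; rewrite gt_eqF// (lt_le_trans _ tx)// ltrDl.
Qed.

Lemma isqrt_dist_integrable_lt t c : mu.-integrable `[c, t[ (EFin \o isqrt_dist t).
Proof.
rewrite itv_bnd_open_bigcup; apply: (@ge0_integrable_bigcup _ _ (2 * Num.sqrt (t - c))) => //.
- apply/nondecreasing_seqP => n; apply/subsetPset; apply: subset_itvl.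
  by rewrite bnd_simp lerD2l lerN2 lef_pV2 ?posrE ?ltr0n// ler_nat.
- move=> n; apply: continuous_compact_integrable; first exact: segment_compact.
  apply: continuous_in_subspaceT => x; rewrite inE/= in_itv/= => /andP[_ tx].
  by apply: isqrt_dist_continuous; rewrite lt_eqF// (le_lt_trans tx)// gtrBl invr_gt0 ltr0n.
- by move=> x; exact: isqrt_dist_ge0.
- move=> n.
  have n0 : 0 < n.+1%:R^-1 :> R by rewrite invr_gt0.
  have [nd|dn] := leP c (t - n.+1%:R^-1); last first.
    by rewrite set_itv_ge ?Rintegral_set0 ?mulr_ge0 ?sqrtr_ge0// bnd_simp -ltNge.
  have dK (x : R) : c <= x <= t - n.+1%:R^-1 ->
      is_derive x (1 : R) (fun x => - 2 * Num.sqrt (t - x)) (isqrt_dist t x).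
    by move=> /andP[_ nx]; apply: isqrt_dist_deriveN; rewrite (le_lt_trans nx)// gtrBl.
  rewrite (within_derive_FTC2 nd dK).
    by rewrite !mulNr opprK gerDr oppr_le0 mulr_ge0 ?sqrtr_ge0.
  apply: continuous_in_subspaceT => x; rewrite inE/= in_itv/= => /andP[_ tx].
  by apply: isqrt_dist_continuous; rewrite lt_eqF// (le_lt_trans tx)// gtrBl.
Qed.

Lemma isqrt_dist_integrable t c d : mu.-integrable `[c, d] (EFin \o isqrt_dist t).
Proof.
have /(integrable_mkcond _ _) i1 := isqrt_dist_integrable_lt t c.
have /(integrable_mkcond _ _) i2 := isqrt_dist_integrable_gt t d.
apply/integrable_mkcond => //; rewrite restrict_EFin.
have mg : measurable_fun (setT : set (measurableTypeR R)) (isqrt_dist t).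
  apply: (@measurable_fun_punctured _ _ t); first exact: openT.
  by move=> x _; exact: isqrt_dist_continuous.
rewrite restrict_EFin in i1; rewrite restrict_EFin in i2.
apply: le_integrable (integrable_EFinD _ (i1 _) (i2 _)) => //.
  apply/measurable_EFinP; apply/(measurable_restrictT _ _).1 => //.
  exact: measurable_funTS.
have g0 := isqrt_dist_ge0 t.
move=> x _; rewrite /= lee_fin !patchE [leRHS]ger0_norm; last first.
  by rewrite addr_ge0//; case: ifP.
case: ifPn => [|_]; last by rewrite normr0 addr_ge0//; case: ifP.
rewrite inE/= in_itv/= => /andP[cx xd]; rewrite ger0_norm//.
rewrite !mem_setE !in_itv/= cx xd andbT.
case: ltgtP => [_|_|->]; rewrite ?addr0 ?add0r//.
(* The point [t] belongs to neither half-open piece, but the function is 0 there by the convention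
   [0^-1 = 0]. *)
by rewrite /isqrt_dist subrr normr0 sqrtr0 invr0.
Qed.

End WeakSingularity.

(** * Size of the logarithmic kernel *)

Section Kernels.
Context {R : realType}.
Notation mu := (@lebesgue_measure R).
Implicit Types (a b c d s t u w x y T : R).

(** Up to the factor [pi / (2 * T)], [u + w] and [u - w] are the maximum and the minimum of [s] and
    [t]. The strict bound on [u] holds because distinct points of [[0, T]] have a sum below
    [2 * T]. *)
Lemma kernel_angles T s t (u := pi * (s + t) / (4 * T))
    (w := pi * `|t - s| / (4 * T)) :
  0 < T -> 0 <= s <= T -> 0 <= t <= T -> s != t ->
  [/\ 0 < w, w <= u, u + w <= pi / 2 & u < pi / 2].
Proof.
move=> T0 /andP[s0 sT] /andP[t0 tT] st.
have pi0 : 0 < pi :> R := pi_gt0 R.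
pose p := pi / (4 * T).
have p0 : 0 < p by rewrite divr_gt0// mulr_gt0.
have uE : u = p * (s + t) by rewrite /u /p mulrAC.
have wE : w = p * `|t - s| by rewrite /w /p mulrAC.
have piE : pi / 2 = p * (2 * T) by rewrite /p; field; rewrite gt_eqF.
rewrite uE wE piE -mulrDr ler_pM2l// ler_pM2l// ltr_pM2l//.
rewrite mulr_gt0 ?normr_gt0 ?subr_eq0 1?eq_sym//.
have [ts|st'] := leP s t.
  rewrite ger0_norm ?subr_ge0//; have : s < t by rewrite lt_neqAle st.
  by move=> ?; split => //; lra.
by rewrite ltr0_norm ?subr_lt0//; split => //; lra.
Qed.

(** Mean value theorem: the derivative [(cos x) ^- 2] is at least 1. *)
Lemma le_tan w : 0 <= w -> w < pi / 2 -> w <= tan w.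
Proof.
move=> w0 wpi.
have [->|w_neq0] := eqVneq w 0; first by rewrite tan0.
have {}w0 : 0 < w by rewrite lt_neqAle eq_sym w_neq0.
have cos0 x : 0 <= x <= w -> 0 < cos x.
  by move=> /andP[x0 xw]; apply: cos_gt0_pihalf; have := pi_gt0 R; lra.
have dtan (x : R) : x \in `]0, w[ -> is_derive x (1 : R) tan ((cos x) ^- 2).
  rewrite in_itv/= => /andP[x0 xw].
  by apply: is_derive_tan; rewrite gt_eqF// cos0// !ltW.
have ctan : {within `[0, w], continuous (tan : R -> R)}.
  apply: continuous_in_subspaceT => x; rewrite inE/= in_itv/= => xw.
  by apply: continuous_tan; rewrite gt_eqF// cos0.
have [z] := MVT w0 dtan ctan; rewrite in_itv/= tan0 !subr0 => /andP[z0 zw] ->.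
have cz : 0 < cos z by rewrite cos0// !ltW.
rewrite ler_pMl// invf_ge1 ?exprn_gt0// expr_le1 ?cos_le1 ?(ltW cz)//.
Qed.

(** With [y] the fourth root of [x], [- ln x] is [4 * ln y^-1], and the logarithm lies below the
    identity. *)
Lemma ln_ge_sqrt4 x : 0 < x -> - ln x <= 4 * (Num.sqrt (Num.sqrt x))^-1.
Proof.
move=> x0; set y := Num.sqrt (Num.sqrt x).
have y0 : 0 < y by rewrite !sqrtr_gt0.
have -> : x = (y ^+ 2) ^+ 2 by rewrite /y !sqr_sqrtr ?sqrtr_ge0// ltW.
rewrite -exprM lnXn// -mulNrn -lnV ?posrE// mulr_natl ler_pMn2r//.
by rewrite ltW// ln_sublinear// invr_gt0.
Qed.

(* With u, w as in kernel_angles, w <= u <= pi/2 - w, so that tan u * tan w lies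
   between w^2 and 1. *)
Lemma log_kernel_bound T s t : 0 < T -> 0 <= s <= T -> 0 <= t <= T -> s != t ->
  0 <= log_kernel T s t <=
    8 / pi * (Num.sqrt (Num.sqrt (pi / (4 * T))))^-1 * (Num.sqrt (Num.sqrt `|s - t|))^-1.
Proof.
move=> T0 hs ht st; have [w0 wu uw upi] := kernel_angles T0 hs ht st.
have pi0 : 0 < pi :> R := pi_gt0 R.
rewrite /log_kernel; set u := pi * (s + t) / _ in wu uw upi *.
set w := pi * _ / _ in w0 wu uw *.
have wpi : w < pi / 2 by exact: le_lt_trans upi.
have u0 : 0 < u by exact: lt_le_trans wu.
have cw : 0 < cos w by apply: cos_gt0_pihalf; lra.
have cu : 0 < cos u by apply: cos_gt0_pihalf; lra.
have tw : w <= tan w by apply: le_tan => //; exact: ltW.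
have tu : w <= tan u by apply: (le_trans wu); apply: le_tan => //; exact: ltW.
have tw0 : 0 < tan w := lt_le_trans w0 tw.
have tu0 : 0 < tan u := lt_le_trans w0 tu.
have ww0 : 0 < w * w := mulr_gt0 w0 w0.
have twu1 : tan u * tan w <= 1.
  rewrite /tan mulrACA -invfM ler_pdivrMr ?mulr_gt0// mul1r -subr_ge0 -cosD.
  by apply: cos_ge0_pihalf; lra.
have tuw0 : 0 < tan u * tan w := mulr_gt0 tu0 tw0.
rewrite mulNr -mulrN; apply/andP; split.
  by rewrite mulr_ge0 ?invr_ge0 ?(ltW pi0)// oppr_ge0 ln_le0.
have : - ln (tan u * tan w) <= 2 * (4 * (Num.sqrt (Num.sqrt w))^-1).
  apply: (@le_trans _ _ (2 * - ln w)); last by rewrite ler_pM2l// ln_ge_sqrt4.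
  rewrite mulrN lerN2 mulr_natl mulr2n -lnM ?posrE// ler_ln ?posrE//.
  by rewrite ler_pM// (ltW w0).
move=> h; apply: (@le_trans _ _ (pi^-1 * (2 * (4 * (Num.sqrt (Num.sqrt w))^-1)))).
  by rewrite ler_pM2l ?invr_gt0.
have -> : w = pi / (4 * T) * `|s - t| by rewrite /w distrC mulrAC.
have p0 : 0 <= pi / (4 * T) by rewrite divr_ge0 ?mulr_ge0 ?(ltW pi0) ?(ltW T0).
rewrite (sqrtrM _ p0) sqrtrM ?sqrtr_ge0// invfM.
by rewrite le_eqVlt; apply/orP; left; apply/eqP; ring.
Qed.

End Kernels.

(** * The logarithmic kernel as a primitive *)

Section KernelDerivative.
Context {R : realType}.
Notation mu := (@lebesgue_measure R).
Implicit Types (a b c d s t u w x y T : R).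

Lemma sin_half x : sin x = 2 * cos (x / 2) * sin (x / 2).
Proof.
by rewrite {1}(splitr x) -mulr2n sin_mulr2n mulr2n; ring.
Qed.

(** The two logarithmic derivatives add up, [ln (tan y)] having derivative [1 / (cos y * sin y)]. *)
Lemma ln_tan_tan_derive p q (al be x : R) :
  0 < al * x + be < pi / 2 -> 0 < p * x + q < pi / 2 ->
  is_derive x (1 : R) (fun z => ln (tan (al * z + be) * tan (p * z + q)))
    (al / (cos (al * x + be) * sin (al * x + be)) +
     p / (cos (p * x + q) * sin (p * x + q))).
Proof.
move=> /andP[u0 u1] /andP[w0 w1].
have daff (m n y : R) : is_derive y (1 : R) (fun z => m * z + n) m.
  by apply: is_derive_eq; rewrite scaler1 addr0.
have cosu : 0 < cos (al * x + be) by apply: cos_gt0_pihalf; have := pi_gt0 R; lra.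
have cosw : 0 < cos (p * x + q) by apply: cos_gt0_pihalf; have := pi_gt0 R; lra.
have sinu : 0 < sin (al * x + be) by apply: sin_gt0_pihalf; rewrite u0.
have sinw : 0 < sin (p * x + q) by apply: sin_gt0_pihalf; rewrite w0.
have dt1 := @is_derive1_comp _ tan (fun z => al * z + be) _ _ _
  (is_derive_tan (lt0r_neq0 cosu)) (daff al be x).
have dt2 := @is_derive1_comp _ tan (fun z => p * z + q) _ _ _
  (is_derive_tan (lt0r_neq0 cosw)) (daff p q x).
have tt0 : 0 < tan (al * x + be) * tan (p * x + q).
  by rewrite mulr_gt0// divr_gt0.
have D := @is_derive1_comp _ (@ln R) (fun z => tan (al * z + be) * tan (p * z + q)) _ _ _
  (is_derive1_ln tt0) (is_deriveM dt1 dt2).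
apply: (@is_derive_eq _ _ _ _ _ _ _ _ D).
rewrite /GRing.scale/= /tan.
move: cosu cosw sinu sinw => /lt0r_neq0 + /lt0r_neq0 + /lt0r_neq0 + /lt0r_neq0.
move: (cos _) (cos _) (sin _) (sin _) => c1 c2 s1 s2 ? ? ? ?.
field; by do ?[apply/andP; split].
Qed.

(** By the double angle formula [1 / (cos y * sin y)] is [2 / sin (2 * y)]: this turns the angles
    over [4 * T] into those over [2 * T], and [pi^-1 * (pi / (4 * T)) * 2] is the prefactor
    [(2 * T)^-1]. *)
Lemma log_kernel_derive T s t : 0 < T -> 0 <= s <= T -> 0 <= t <= T -> s != t ->
  is_derive s (1 : R) (fun s => log_kernel T s t) (- mhilbert_kernel T s t).
Proof.
move=> T0 hs ht st; have [w0 wu uw upi] := kernel_angles T0 hs ht st.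
have pi0 : 0 < pi :> R := pi_gt0 R.
pose p : R := pi / (4 * T).
have p0 : 0 < p by rewrite divr_gt0// mulr_gt0.
have pT : 2 * p * T = pi / 2 by rewrite /p; field; rewrite gt_eqF.
(* [sg] is the sign of [s - t]: near [s] it makes the absolute value affine, and treats both sides
   of [t] at once. It disappears in the end because the sine is odd and the cosine even. *)
have [sg [sg1 sgE sgst]] : exists sg : R, [/\ sg = 1 \/ sg = -1,
    \near s, sg * (s - t) = `|t - s| & sg * (s - t) = `|t - s|].
  move: st; rewrite neq_lt => /orP[st|ts].
    have near_st : \near s, -1 * (s - t) = `|t - s|.
      near=> z; rewrite mulN1r opprB ger0_norm// subr_ge0 ltW//.
      by near: z; exact: lt_nbhsl.
    by exists (- 1); split; [right| |exact: nbhs_singleton near_st].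
  have near_st : \near s, 1 * (s - t) = `|t - s|.
    near=> z; rewrite mul1r ler0_norm ?opprB// subr_le0 ltW//.
    by near: z; exact: lt_nbhsr.
  by exists 1; split; [left| |exact: nbhs_singleton near_st].
have uE z : p * z + p * t = pi * (z + t) / (4 * T) by rewrite /p; field; rewrite gt_eqF.
have wE z : sg * p * z + - (sg * p * t) = pi * (sg * (z - t)) / (4 * T).
  by rewrite /p; field; rewrite gt_eqF.
have hu : 0 < p * s + p * t < pi / 2 by rewrite uE upi (lt_le_trans w0).
have hw : 0 < sg * p * s + - (sg * p * t) < pi / 2.
  by rewrite wE sgst w0 (le_lt_trans wu).
have D := ln_tan_tan_derive hu hw.
apply: (near_eq_is_derive (f := fun z => - pi^-1 *
  ln (tan (p * z + p * t) * tan (sg * p * z + - (sg * p * t))))).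
  near=> z; rewrite /log_kernel uE wE; congr (- pi^-1 * ln (_ * tan (pi * _ / _))).
  by near: z.
apply: (is_derive_eq (is_deriveZ (- pi^-1) D)).
rewrite /mhilbert_kernel (sin_half (pi * (s + t) / (2 * T))) (sin_half (pi * (s - t) / (2 * T))).
have -> : pi * (s + t) / (2 * T) / 2 = p * s + p * t by rewrite /p; field; rewrite gt_eqF.
have -> : sin (pi * (s - t) / (2 * T) / 2) = sg * sin (sg * p * s + - (sg * p * t)).
  have -> : pi * (s - t) / (2 * T) / 2 = p * s - p * t by rewrite /p; field; rewrite gt_eqF.
  case: sg1 => ->; first by rewrite !mul1r.
  by rewrite mulN1r -sinN !mulN1r mulNr opprD !opprK; congr (sin (_ + _)); rewrite mulNr.
have -> : cos (pi * (s - t) / (2 * T) / 2) = cos (sg * p * s + - (sg * p * t)).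
  have -> : pi * (s - t) / (2 * T) / 2 = p * s - p * t by rewrite /p; field; rewrite gt_eqF.
  case: sg1 => ->; first by rewrite !mul1r.
  by rewrite -[LHS]cosN; congr cos; ring.
have pE : p = pi / (4 * T) by [].
have /andP[hu0 hu1] := hu; have /andP[hw0 hw1] := hw.
have cosu : cos (p * s + p * t) != 0 by rewrite gt_eqF// cos_gt0_pihalf//; lra.
have sinu : sin (p * s + p * t) != 0 by rewrite gt_eqF// sin_gt0_pihalf.
have cosw : cos (sg * p * s + - (sg * p * t)) != 0 by rewrite gt_eqF// cos_gt0_pihalf//; lra.
have sinw : sin (sg * p * s + - (sg * p * t)) != 0 by rewrite gt_eqF// sin_gt0_pihalf.
move: cosu sinu cosw sinw.
move: (cos _) (cos _) (sin _) (sin _) => c1 c2 s1 s2 c10 s10 c20 s20.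
rewrite /GRing.scale/= pE.
move: (lt0r_neq0 T0) (lt0r_neq0 pi0); move: (pi) => q T1 q0.
by case: sg1 => ->; field; rewrite s10 s20 c10 c20 T1 q0.
Unshelve. all: by end_near. Qed.

Lemma log_kernel_continuous T s t : 0 < T -> 0 <= s <= T -> 0 <= t <= T -> s != t ->
  {for s, continuous (fun s => log_kernel T s t)}.
Proof.
move=> T0 hs ht st.
exact: (is_derive_continuous (f' := fun s => - mhilbert_kernel T s t)
  (log_kernel_derive T0 hs ht st)).
Qed.

(** The arguments of the sines are [2 * u] and, up to sign, [2 * w] for the angles of
    [kernel_angles], both strictly between 0 and [pi]. *)
Lemma mhilbert_kernel_continuous T s t :
  0 < T -> 0 <= s <= T -> 0 <= t <= T -> s != t ->
  {for s, continuous (fun s => mhilbert_kernel T s t)}.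
Proof.
move=> T0 hs ht st; have [w0 wu uw upi] := kernel_angles T0 hs ht st.
have pi0 : 0 < pi :> R := pi_gt0 R.
have csin (e : R) : sin (pi * (s + e) / (2 * T)) != 0 ->
    {for s, continuous (fun s => (sin (pi * (s + e) / (2 * T)))^-1)}.
  move=> s0; apply: continuousV => //.
  apply: continuous_comp; last exact: continuous_sin.
  apply: continuousM; last exact: cst_continuous.
  apply: continuousM; first exact: cst_continuous.
  by apply: continuousD; [exact: cvg_id|exact: cst_continuous].
apply: continuousM; first exact: cst_continuous.
apply: continuousD; apply: csin.
  rewrite gt_eqF// sin_gt0_pi//.
  have -> : pi * (s + t) / (2 * T) = 2 * (pi * (s + t) / (4 * T)) by field; rewrite gt_eqF.
  by apply/andP; split; lra.
have -> : pi * (s - t) / (2 * T) = 2 * (pi * (s - t) / (4 * T)) by field; rewrite gt_eqF.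
have [lts|lst] := leP t s.
  rewrite ler0_norm ?subr_le0// opprB in w0 wu uw.
  by rewrite gt_eqF// sin_gt0_pi//; apply/andP; split; lra.
rewrite gtr0_norm ?subr_gt0// in w0 wu uw.
have -> : 2 * (pi * (s - t) / (4 * T)) = - (2 * (pi * (t - s) / (4 * T))) by ring.
by rewrite sinN oppr_eq0 gt_eqF// sin_gt0_pi//; apply/andP; split; lra.
Qed.

End KernelDerivative.

(** * The principal value *)

Section TruncatedIntegral.
Context {R : realType}.
Notation mu := (@lebesgue_measure R).
Implicit Types (f g h : R -> R) (a b c d s t u w x y T : R).

Lemma integrable_disjoint_setU (A B : set (measurableTypeR R)) g :
  measurable A -> measurable B -> [disjoint A & B] ->
  mu.-integrable A (EFin \o g) -> mu.-integrable B (EFin \o g) ->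
  mu.-integrable (A `|` B) (EFin \o g).
Proof.
move=> mA mB AB /integrableP[mgA ltA] /integrableP[mgB ltB].
have mg : measurable_fun (A `|` B) (EFin \o g) by apply/measurable_funU.
apply/integrableP; split => //.
rewrite ge0_integral_setU//; first exact: lte_add_pinfty.
exact: measurableT_comp.
Qed.

(** Avoids a case analysis on the endpoints of truncated domains: [a] or [b] may be missing from
    them when it equals 0 or [T], and points at distance exactly [eps] from [t] are excluded. *)
Lemma between_itv (D : set R) c d : `]c, d[ `<=` D -> D `<=` `[c, d] ->
  exists b1 b2 : bool, D = [set` Interval (BSide b1 c) (BSide b2 d)].
Proof.
move=> cdD Dcd; exists (c \in D), (d \notin D); apply/seteqP; split=> x.
  move=> Dx; have := Dcd _ Dx; rewrite /= !in_itv/= => /andP[cx xd].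
  apply/andP; split.
    move: cx; rewrite le_eqVlt => /predU1P[cx|cx]; first by rewrite cx mem_set//= lexx.
    by case: (c \in D) => //=; exact: ltW.
  move: xd; rewrite le_eqVlt => /predU1P[xd|xd]; first by rewrite -xd mem_set//= lexx.
  by case: (d \notin D) => //=; exact: ltW.
rewrite /= in_itv/= => /andP[].
have [cD|cD] := boolP (c \in D); have [dD|dD] := boolP (d \in D);
  rewrite /= ?bnd_simp => cx xd.
- move: cx; rewrite le_eqVlt => /predU1P[<-|cx]; first by rewrite inE in cD.
  move: xd; rewrite le_eqVlt => /predU1P[->|xd]; first by rewrite inE in dD.
  by apply: cdD; rewrite /= in_itv/= cx.
- move: cx; rewrite le_eqVlt => /predU1P[<-|cx]; first by rewrite inE in cD.
  by apply: cdD; rewrite /= in_itv/= cx.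
- move: xd; rewrite le_eqVlt => /predU1P[->|xd]; first by rewrite inE in dD.
  by apply: cdD; rewrite /= in_itv/= cx.
- by apply: cdD; rewrite /= in_itv/= cx.
Qed.

Lemma Rintegral_between (D : set R) c d g : `]c, d[ `<=` D -> D `<=` `[c, d] ->
  mu.-integrable `[c, d] (EFin \o g) ->
  \int[mu]_(x in D) g x = \int[mu]_(x in `[c, d]) g x.
Proof.
move=> cdD Dcd ig; have [b1 [b2 DE]] := between_itv cdD Dcd.
have igS (e1 e2 : bool) : mu.-integrable [set` Interval (BSide e1 c) (BSide e2 d)] (EFin \o g).
  by apply: integrableS ig => //; apply: subset_itv; rewrite bnd_simp; case: e1; case: e2.
rewrite DE; case: b1 {DE}; case: b2.
- by rewrite Rintegral_itv_bndo_bndc.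
- by [].
- by rewrite Rintegral_itv_bndo_bndc// Rintegral_itv_obnd_cbnd.
- by rewrite Rintegral_itv_obnd_cbnd.
Qed.

(* The minimum and maximum make an interval empty when [a, b] does not meet the
   corresponding side of t. *)
Lemma mhilbert_trunc_split T a b f t eps : 0 < T -> 0 <= a -> b <= T ->
  0 <= t <= T -> 0 < eps -> {within `[a, b], continuous f} ->
  mhilbert_trunc T (zero_ext `[a, b] f) t eps =
  \int[mu]_(s in `[a, Num.min b (t - eps)]) (f s * mhilbert_kernel T s t) +
  \int[mu]_(s in `[Num.max a (t + eps), b]) (f s * mhilbert_kernel T s t).
Proof.
move=> T0 a0 bT ht eps0 cf.
pose g s := f s * mhilbert_kernel T s t.
have ig c d : a <= c -> d <= b -> (d < t) || (t < c) -> mu.-integrable `[c, d] (EFin \o g).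
  move=> ac db cdt; apply: continuous_compact_integrable; first exact: segment_compact.
  apply: within_continuousM.
    by apply: continuous_subspaceW cf; apply: subset_itv; rewrite bnd_simp.
  apply: continuous_in_subspaceT => s; rewrite inE/= in_itv/= => /andP[cs sd].
  apply: mhilbert_kernel_continuous => //; first by apply/andP; split; lra.
  by case/orP: cdt => H; apply/eqP => e; move: H; rewrite -e ltNge ?sd ?cs.
pose D := [set s | 0 < s < T /\ eps < `|s - t|] `&` `[a, b].
pose DL := D `&` [set s | s < t].
pose DR := D `&` [set s | t < s].
have DE : D = DL `|` DR.
  rewrite /DL /DR -setIUr; apply/esym/setIidl => s -[[_ est] _].
  have : s - t != 0 by rewrite -normr_gt0 (lt_trans eps0).
  by rewrite subr_eq0 neq_lt => /orP[]; [left|right].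
have igL : mu.-integrable `[a, Num.min b (t - eps)] (EFin \o g).
  by apply: ig => //; [rewrite ge_min lexx|rewrite gt_min gtrBl eps0 orbT].
have igR : mu.-integrable `[Num.max a (t + eps), b] (EFin \o g).
  by apply: ig => //; [rewrite le_max lexx|rewrite lt_max ltrDl eps0 !orbT].
have DL1 : `]a, Num.min b (t - eps)[ `<=` DL.
  move=> s; rewrite /= in_itv/= lt_min => /andP[sa /andP[sb st]].
  have st' : s < t by lra.
  split; last by [].
  split; last by rewrite /= in_itv/=; apply/andP; split; lra.
  split; first by apply/andP; split; lra.
  by rewrite ltr0_norm ?subr_lt0//; lra.
have DL2 : DL `<=` `[a, Num.min b (t - eps)].
  move=> s [[[_ est]]]; rewrite /= !in_itv/= => /andP[sa sb] st.
  by rewrite sa le_min sb/=; move: est; rewrite ltr0_norm ?subr_lt0//; lra.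
have DR1 : `]Num.max a (t + eps), b[ `<=` DR.
  move=> s; rewrite /= in_itv/= gt_max => /andP[/andP[sa st] sb].
  have st' : t < s by lra.
  split; last by [].
  split; last by rewrite /= in_itv/=; apply/andP; split; lra.
  split; first by apply/andP; split; lra.
  by rewrite gtr0_norm ?subr_gt0//; lra.
have DR2 : DR `<=` `[Num.max a (t + eps), b].
  move=> s [[[_ est]]]; rewrite /= !in_itv/= => /andP[sa sb] st.
  by rewrite sb ge_max sa/= andbT; move: est; rewrite gtr0_norm ?subr_gt0//; lra.
have [? [? DLE]] := between_itv DL1 DL2.
have [? [? DRE]] := between_itv DR1 DR2.
have mDL : measurable (DL : set (measurableTypeR R)) by rewrite DLE.
have mDR : measurable (DR : set (measurableTypeR R)) by rewrite DRE.
have LR : [disjoint DL & DR].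
  apply/disj_set2P; rewrite -subset0 => s [[_ /= st] [_ /= ts]].
  by have := lt_trans st ts; rewrite ltxx.
rewrite -(Rintegral_between DL1 DL2 igL) -(Rintegral_between DR1 DR2 igR).
rewrite -Rintegral_setU//; last first.
  apply: integrable_disjoint_setU => //.
    by apply: integrableS igL.
  by apply: integrableS igR.
rewrite -DE /D Rintegral_mkcondr; apply: eq_Rintegral => s _.
by rewrite /zero_ext !patchE; case: ifP => // _; rewrite mul0r.
Qed.

(** Convergence selects the principal value branch of [mhilbert], so the representative chosen by
    [get] does not enter. *)
Lemma mhilbert_of_cvg T (v : R -> R) t (l : R) :
  mhilbert_trunc T v t eps @[eps --> 0^'+] --> l ->
  mhilbert_pv_exists T v t /\ mhilbert T v t = l.
Proof.
move=> vl; have pv : mhilbert_pv_exists T v t by apply/cvg_ex; exists l.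
by split=> //; rewrite /mhilbert; case: asboolP => // _; exact: cvg_lim vl.
Qed.

(** The majorant comes from [x * y <= x ^ 2 + y ^ 2], applied to [|h s|] and the bound of order |s -
    t|^(-1/4) on the kernel. *)
Lemma L2_log_kernel_integrable T a b h t : 0 < T -> 0 <= a -> b <= T ->
  0 <= t <= T -> L2_on a b h ->
  mu.-integrable `]a, b[ (EFin \o (fun s => h s * log_kernel T s t)).
Proof.
move=> T0 a0 bT ht h2.
set h0 := zero_ext `]a, b[ h.
have ih2 := L2_on_sqr_integrable h2; have mh := L2_on_measurable h2.
have mk : measurable_fun (`]a, b[ : set (measurableTypeR R)) (fun s => log_kernel T s t).
  apply: (@measurable_fun_punctured _ _ _ t); first exact: interval_open.
  move=> s; rewrite /= in_itv/= => /andP[as_ sb] st.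
  by apply: log_kernel_continuous => //; apply/andP; split; lra.
set C := 8 / pi * (Num.sqrt (Num.sqrt (pi / (4 * T))))^-1.
have ibound : mu.-integrable `]a, b[ (EFin \o
    (fun s => h0 s ^+ 2 + C ^+ 2 * isqrt_dist t s)).
  apply: integrable_EFinD => //.
    by apply: integrableS ih2.
  have i1 : mu.-integrable `[a, b] (EFin \o isqrt_dist t) by exact: isqrt_dist_integrable.
  have {}i1 : mu.-integrable `]a, b[ (EFin \o isqrt_dist t).
    by apply: integrableS i1 => //; exact: subset_itv_oo_cc.
  exact: (integrableZl _ (C ^+ 2) i1).
apply: le_integrable ibound => //.
  apply/measurable_EFinP; apply: measurable_funM => //.
  by apply/(measurable_restrictT _ _).2 => //; exact: mh.
move=> s; rewrite /= in_itv/= => sab; rewrite lee_fin [leRHS]ger0_norm; last first.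
  by rewrite addr_ge0 ?sqr_ge0// mulr_ge0 ?sqr_ge0// isqrt_dist_ge0.
have -> : h0 s = h s by rewrite /h0 /zero_ext patchE mem_set//= in_itv.
(* At [s = t] the kernel takes the default value 0, since [tan 0 = 0] and [ln] is 0 at 0. *)
have [->|st] := eqVneq s t.
  rewrite /log_kernel subrr normr0 mulr0 mul0r tan0 mulr0 ln0// mulr0 mulr0 normr0.
  by rewrite addr_ge0 ?sqr_ge0// mulr_ge0 ?sqr_ge0// isqrt_dist_ge0.
have hs : 0 <= s <= T by apply/andP; split; lra.
have /andP[k0 kC] := log_kernel_bound T0 hs ht st.
rewrite normrM (ger0_norm k0) -[h s ^+ 2]real_normK ?num_real//.
move: kC; rewrite -/C; set q := _^-1 => kC.
have -> : isqrt_dist t s = q ^+ 2 by rewrite exprVn sqr_sqrtr ?sqrtr_ge0.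
rewrite -exprMn (@le_trans _ _ (`|h s| * (C * q)))//; first by rewrite ler_wpM2l.
have := sqr_ge0 (`|h s| - C * q); have := normr_ge0 (h s).
have := le_trans k0 kC; move: (C * q) (`|h s|) => x y x0 y0.
by nra.
Qed.

End TruncatedIntegral.

(** * One-sided limits of the truncated integrals *)

Section Limits.
Context {R : realType}.
Notation mu := (@lebesgue_measure R).

(** Both kernels contain the factor [tan (p * eps)], whose logarithm drops out of the difference.
    What remains is [phi (2 * t + eps) - phi (2 * t - eps)], and [phi] is continuous at [2 * t]
    because [0 < 2 * t < 2 * T]. *)
Lemma log_kernel_sym_cvg (T t : R) : 0 < T -> 0 < t < T ->
  log_kernel T (t + eps) t - log_kernel T (t - eps) t @[eps --> 0^'+] --> (0 : R).
Proof.
move=> T0 /andP[t0 tT].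
have pi0 : 0 < pi :> R := pi_gt0 R.
pose p : R := pi / (4 * T).
have p0 : 0 < p by rewrite divr_gt0// mulr_gt0.
have pT : p * (2 * T) = pi / 2.
  by rewrite /p; move: (lt0r_neq0 T0) => T1; field.
have tan_gt0 (x : R) : 0 < x < 2 * T -> 0 < tan (p * x).
  move=> /andP[x0 xT].
  have px0 : 0 < p * x by rewrite mulr_gt0.
  have pxT : p * x < pi / 2 by rewrite -pT ltr_pM2l.
  by rewrite divr_gt0 ?sin_gt0_pihalf ?cos_gt0_pihalf//; apply/andP; split; lra.
have pE x : pi * x / (4 * T) = p * x by rewrite /p mulrAC.
pose phi x := - pi^-1 * ln (tan (p * x)).
have cphi : {for 2 * t, continuous phi}.
  have tt : 0 < 2 * t < 2 * T by apply/andP; split; lra.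
  apply: continuousM; first exact: cst_continuous.
  apply: continuous_comp; last by apply: continuous_ln; exact: tan_gt0.
  apply: continuous_comp.
    by apply: continuousM; [exact: cst_continuous|exact: cvg_id].
  apply: continuous_tan; rewrite gt_eqF// cos_gt0_pihalf//.
  have px0 : 0 < p * (2 * t) by rewrite mulr_gt0//; lra.
  have pxT : p * (2 * t) < pi / 2 by rewrite -pT ltr_pM2l//; lra.
  by apply/andP; split; lra.
have phic (sg : R) : phi (2 * t + sg * eps) @[eps --> 0^'+] --> phi (2 * t).
  have c0 : {for 0, continuous (fun eps => phi (2 * t + sg * eps))}.
    apply: continuous_comp; last by rewrite /= mulr0 addr0.
    apply: continuousD; first exact: cst_continuous.
    by apply: continuousM; [exact: cst_continuous|exact: cvg_id].
  apply: cvg_at_right_filter; move: c0; rewrite /prop_for /continuous_at /= mulr0 addr0.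
  exact.
have : phi (2 * t + 1 * eps) - phi (2 * t + -1 * eps) @[eps --> 0^'+] --> (0 : R).
  by rewrite -[X in _ --> X](subrr (phi (2 * t))); apply: cvgB; exact: phic.
apply: cvg_trans; apply: near_eq_cvg; near=> eps.
have e0 : 0 < eps by [].
have et : eps < t by near: eps; exact: nbhs_right_lt.
have eT : eps < T - t by near: eps; apply: nbhs_right_lt; rewrite subr_gt0.
have te : 0 < tan (p * eps) by apply: tan_gt0; apply/andP; split; lra.
rewrite /log_kernel /phi -!mulrBr.
have -> : t - (t + eps) = - eps by ring.
have -> : t - (t - eps) = eps by ring.
rewrite normrN (gtr0_norm e0) !pE.
have -> : 2 * t + 1 * eps = t + eps + t by ring.
have -> : 2 * t + -1 * eps = t - eps + t by ring.
have t1 : 0 < tan (p * (t + eps + t)) by apply: tan_gt0; apply/andP; split; lra.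
have t2 : 0 < tan (p * (t - eps + t)) by apply: tan_gt0; apply/andP; split; lra.
by rewrite lnM ?posrE// lnM ?posrE// opprD addrACA subrr addr0.
Unshelve. all: by end_near. Qed.

Variables (T a b : R) (f h : R -> R) (t : R).
Hypotheses (T0 : 0 < T) (a0 : 0 <= a) (bT : b <= T)
  (ht : 0 <= t <= T)
  (cf : {within `[a, b], continuous f})
  (ih : mu.-integrable setT (EFin \o h))
  (ih2 : mu.-integrable setT (EFin \o (fun t => h t ^+ 2)))
  (fh : forall x y : R, a <= x -> x <= y -> y <= b ->
    f y - f x = \int[mu]_(t in `[x, y]) h t)
  (ihk : mu.-integrable `[a, b] (EFin \o (fun s => h s * log_kernel T s t))).

Let g s := f s * mhilbert_kernel T s t.
Let k s := log_kernel T s t.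

Lemma log_kernel_by_parts (c d : R) : a <= c -> c <= d -> d <= b ->
  (d < t) || (t < c) ->
  \int[mu]_(s in `[c, d]) g s = f c * k c - f d * k d +
    \int[mu]_(s in `[c, d]) (h s * k s).
Proof.
move=> ac cd db cdt.
have st (s : R) : c <= s <= d -> s != t.
  move=> /andP[cs sd]; apply/eqP => e; move: cdt; rewrite -e !ltNge cs sd//.
have sT (s : R) : c <= s <= d -> 0 <= s <= T.
  move=> /andP[cs sd].
  by rewrite (le_trans a0 (le_trans ac cs)) (le_trans sd (le_trans db bT)).
have sub : `[c, d] `<=` `[a, b] by apply: subset_itv; rewrite bnd_simp.
have dk (s : R) : c <= s <= d -> is_derive s (1 : R) k (- mhilbert_kernel T s t).
  by move=> scd; apply: log_kernel_derive => //; [exact: sT|exact: st].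
have cK : {within `[c, d], continuous (fun s => - mhilbert_kernel T s t)}.
  apply: continuous_in_subspaceT => s; rewrite inE/= in_itv/= => scd.
  by apply: cvgN; apply: mhilbert_kernel_continuous => //; [exact: sT|exact: st].
have cfcd : {within `[c, d], continuous f} by exact: continuous_subspaceW cf.
have fhcd (x y : R) : c <= x -> x <= y -> y <= d -> f y - f x = \int[mu]_(t in `[x, y]) h t.
  by move=> cx xy yd; apply: fh => //; [exact: le_trans cx|exact: le_trans db].
have := absolutely_continuous_by_parts ih ih2 fhcd cfcd dk cK cd.
rewrite (_ : \int[mu]_(s in _) _ = - \int[mu]_(s in `[c, d]) g s).
  by move=> e; rewrite -[LHS]opprK e; ring.
have ig : mu.-integrable `[c, d] (EFin \o g).
  apply: continuous_compact_integrable; first exact: segment_compact.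
  apply: within_continuousM => //; apply: continuous_in_subspaceT => s.
  rewrite inE/= in_itv/= => scd.
  by apply: mhilbert_kernel_continuous => //; [exact: sT|exact: st].
rewrite -mulN1r -RintegralZl//; apply: eq_Rintegral => s _.
by rewrite /g mulN1r mulrN.
Qed.

Let ihkS (c d : R) : a <= c -> d <= b -> mu.-integrable `[c, d] (EFin \o (fun s => h s * k s)).
Proof. by move=> ac db; exact: integrable_itvccS ihk ac db. Qed.

Let A : R := (\int[mu]_t (h t ^+ 2) + 1) / 2.
Let C : R := 8 / pi * (Num.sqrt (Num.sqrt (pi / (4 * T))))^-1.

Let A0 : 0 <= A.
Proof. by rewrite divr_ge0// addr_ge0//; apply: Rintegral_ge0 => s _; exact: sqr_ge0. Qed.

Let C0 : 0 <= C.
Proof.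
rewrite mulr_ge0 ?invr_ge0 ?sqrtr_ge0// divr_ge0//; exact: ltW (pi_gt0 R).
Qed.

(* Modulus of continuity eps^(1/2) of f against the singularity eps^(-1/4). *)
Let jump (x y s eps : R) : a <= x -> x < y -> y <= b -> y - x = eps ->
  0 <= s <= T -> `|s - t| = eps ->
  `|(f y - f x) * k s| <= A * C * Num.sqrt (Num.sqrt eps).
Proof.
move=> ax xy yb yx hs st.
have eps0 : 0 < eps by rewrite -yx subr_gt0.
have s_neq_t : s != t by rewrite -subr_eq0 -normr_gt0 st.
have /andP[k0 kC] := log_kernel_bound T0 hs ht s_neq_t.
rewrite normrM (ger0_norm k0).
have q0 : 0 < Num.sqrt (Num.sqrt eps) by rewrite !sqrtr_gt0.
have -> : A * C * Num.sqrt (Num.sqrt eps) =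
    (A * Num.sqrt eps) * (C * (Num.sqrt (Num.sqrt eps))^-1).
  rewrite -{2}[Num.sqrt eps]sqr_sqrtr ?sqrtr_ge0//; field; exact: lt0r_neq0.
rewrite ler_pM//; last by rewrite -st.
rewrite (fh ax (ltW xy) yb) (le_trans (le_normr_Rintegral _ _))//.
  by apply: integrableS ih.
by rewrite -yx; exact: Rintegral_norm_sqrt.
Qed.

Let sqrt4_near (e : R) : 0 < e ->
  \forall eps \near 0^'+, A * C * Num.sqrt (Num.sqrt eps) <= e.
Proof.
move=> e0; have AC0 : 0 < A * C + 1 by rewrite ltr_wpDl// mulr_ge0.
(* The fourth power undoes the nested square root; [+ 1] keeps the divisor positive. *)
have d0 : 0 < (e / (A * C + 1)) ^+ 2 ^+ 2 by rewrite !exprn_gt0// divr_gt0.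
near=> eps; have eps0 : 0 < eps by [].
have : eps <= (e / (A * C + 1)) ^+ 2 ^+ 2 by near: eps; exact: nbhs_right_le.
rewrite -ler_sqrt ?sqr_ge0// sqrtr_sqr ger0_norm ?sqr_ge0//.
rewrite -ler_sqrt ?sqr_ge0// sqrtr_sqr ger0_norm; last by rewrite divr_ge0 ?ltW.
rewrite ler_pdivlMr// mulrC => H; apply: le_trans H.
by rewrite ler_wpM2r ?sqrtr_ge0// lerDl.
Unshelve. all: by end_near. Qed.

(** The added term turns the boundary term at [t - eps], possibly unbounded, into
    [(f t - f (t - eps)) * k (t - eps)], which [jump] sends to 0. The rest is continuity of the
    indefinite integral of [h * k]. *)
Lemma left_truncation_cvg : a < t -> t <= b ->
  \int[mu]_(s in `[a, t - eps]) g s + f t * k (t - eps) @[eps --> 0^'+] -->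
  f a * k a + \int[mu]_(s in `[a, t]) (h s * k s).
Proof.
move=> at_ tb; have := a0; have := bT; have /andP[t0 tT] := ht; move=> bT' a0'.
apply/cvgrPdist_le => e e0.
have e20 : 0 < e / 2 by rewrite divr_gt0.
have [|r r0 H] := within_continuous_ex (x := t)
  (parameterized_integral_continuous (ltW at_) (ihkS (lexx a) tb)) _ e20.
  by rewrite /= in_itv/= lexx ltW.
near=> eps; have eps0 : 0 < eps by [].
have epsat : eps < t - a by near: eps; apply: nbhs_right_lt; rewrite subr_gt0.
have epsr : eps < r by near: eps; exact: nbhs_right_lt.
have epsA : A * C * Num.sqrt (Num.sqrt eps) <= e / 2 by near: eps; exact: sqrt4_near.
rewrite log_kernel_by_parts ?gtrBl ?eps0//; try lra.
have -> (x1 x2 x3 x4 x5 x6 : R) : x1 + x2 - (x1 - x3 * x4 + x5 + x6 * x4) =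
  (x2 - x5) - (x6 - x3) * x4 by ring.
rewrite (splitr e) (le_trans (ler_normB _ _))// lerD//.
  rewrite distrC; apply: H; first by rewrite /= in_itv/=; apply/andP; split; lra.
  by rewrite addrAC subrr add0r normrN gtr0_norm.
apply: le_trans epsA; apply: jump; try lra.
by rewrite addrAC subrr add0r normrN gtr0_norm.
Unshelve. all: by end_near. Qed.

Lemma right_truncation_cvg : a <= t -> t < b ->
  \int[mu]_(s in `[t + eps, b]) g s - f t * k (t + eps) @[eps --> 0^'+] -->
  - f b * k b + \int[mu]_(s in `[t, b]) (h s * k s).
Proof.
move=> at_ tb; have := a0; have := bT; have /andP[t0 tT] := ht; move=> bT' a0'.
apply/cvgrPdist_le => e e0.
have e20 : 0 < e / 2 by rewrite divr_gt0.
have [|r r0 H] := within_continuous_ex (x := t)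
  (parameterized_integral_continuous (ltW tb) (ihkS at_ (lexx b))) _ e20.
  by rewrite /= in_itv/= lexx ltW.
near=> eps; have eps0 : 0 < eps by [].
have epsat : eps < b - t by near: eps; apply: nbhs_right_lt; rewrite subr_gt0.
have epsr : eps < r by near: eps; exact: nbhs_right_lt.
have epsA : A * C * Num.sqrt (Num.sqrt eps) <= e / 2 by near: eps; exact: sqrt4_near.
rewrite log_kernel_by_parts ?ltrDl ?eps0 ?orbT//; try lra.
(* The missing part of the integral is the one from [t] to [t + eps], which is small by continuity
   at [t] of the indefinite integral started at [t]. *)
rewrite (@Rintegral_itvcc_split _ _ t (t + eps) b) ?lerDl ?(ltW eps0)//; last 2 first.
- exact: ihkS.
- by lra.
have -> (x1 x2 x3 x4 x5 x6 x7 : R) : - x1 * x2 + (x3 + x4) - (x5 * x6 - x1 * x2 + x4 - x7 * x6) =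
  x3 - (x5 - x7) * x6 by ring.
rewrite (splitr e) (le_trans (ler_normB _ _))// lerD//.
  have := H (t + eps); rewrite /parameterized_integral set_itv1 Rintegral_set1 subr0.
  apply; first by rewrite /= in_itv/=; apply/andP; split; lra.
  by rewrite addrAC subrr add0r gtr0_norm.
apply: le_trans epsA; apply: jump; try lra.
by rewrite addrAC subrr add0r gtr0_norm.
Unshelve. all: by end_near. Qed.

End Limits.

(** * The representation formula *)

Theorem lemma2 (R : realType) (T : R) (hT : 0 < T)
  (a b : R) (ha : 0 <= a <= T) (hb : 0 <= b <= T) (hab : a < b)
  (f : R -> R) (hf : sobolev_H1 a b f) (hfc : {within `[a, b], continuous f})
  (df : R -> R) (hdf2 : L2_on a b df) (hdf : weak_derivative a b f df) :
  let vf := zero_ext `[a, b] f in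
  [/\ forall t : R, 0 < t < T -> t != a -> t != b ->
        [/\ log_kernel_integrable T a b df t,
            mhilbert_pv_exists T vf t &
            mhilbert T vf t = - f b * log_kernel T b t + f a * log_kernel T a t
                              + log_kernel_integral T a b df t],
      f a = 0 ->
        [/\ log_kernel_integrable T a b df a,
            mhilbert_pv_exists T vf a &
            mhilbert T vf a = - f b * log_kernel T b a
                              + log_kernel_integral T a b df a] &
      f b = 0 ->
        [/\ log_kernel_integrable T a b df b,
            mhilbert_pv_exists T vf b &
            mhilbert T vf b = f a * log_kernel T a b
                              + log_kernel_integral T a b df b]].
Proof.
move=> vf; have /andP[a0 aT] := ha; have /andP[b0 bT] := hb.
pose mu := @lebesgue_measure R; pose h := zero_ext `]a, b[ df.
have ih : mu.-integrable setT (EFin \o h) by exact: L2_on_integrable.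
have ih2 : mu.-integrable setT (EFin \o (fun s => h s ^+ 2)) by exact: L2_on_sqr_integrable.
have fh (x y : R) : a <= x -> x <= y -> y <= b -> f y - f x = \int[mu]_(s in `[x, y]) h s.
  move=> ax; rewrite le_eqVlt => /predU1P[<- _|xy yb].
    by rewrite set_itv1 Rintegral_set1 subrr.
  exact: weak_derivative_FTC.
have ilog (t : R) : 0 <= t <= T -> log_kernel_integrable T a b df t.
  by move=> ht; exact: L2_log_kernel_integrable.
have hlogE t : (fun s => h s * log_kernel T s t) =
    (fun s => df s * log_kernel T s t) \_ `]a, b[.
  by apply/funext => s; rewrite /h /zero_ext !patchE; case: ifP => // _; rewrite mul0r.
have ihk t : 0 <= t <= T -> mu.-integrable `[a, b] (EFin \o (fun s => h s * log_kernel T s t)).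
  move=> /ilog /(integrable_mkcond _ _) il; rewrite hlogE -restrict_EFin.
  by apply: integrableS (il _).
have logE t : 0 <= t <= T ->
    log_kernel_integral T a b df t = \int[mu]_(s in `[a, b]) (h s * log_kernel T s t).
  move=> ht; rewrite hlogE -Rintegral_mkcondr setIidr; last exact: subset_itv_oo_cc.
  by [].
have far (l r : R) : r < l -> forall g : R -> R, \int[mu]_(s in `[l, r]) g s = 0.
  by move=> rl g; rewrite set_itv_ge ?Rintegral_set0// bnd_simp -ltNge.
have ibp t : 0 <= t <= T -> (b < t) || (t < a) ->
    \int[mu]_(s in `[a, b]) (f s * mhilbert_kernel T s t) =
    f a * log_kernel T a t - f b * log_kernel T b t +
    \int[mu]_(s in `[a, b]) (h s * log_kernel T s t).
  move=> ht tab; exact: (log_kernel_by_parts hT a0 bT ht hfc ih ih2 fh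
    (lexx a) (ltW hab) (lexx b) tab).
split.
- move=> t /andP[t0 tT] ta tb.
  have ht : 0 <= t <= T by rewrite !ltW.
  suff : mhilbert_trunc T vf t eps @[eps --> 0^'+] -->
      - f b * log_kernel T b t + f a * log_kernel T a t + log_kernel_integral T a b df t.
    by move=> /mhilbert_of_cvg[pv ->]; split => //; exact: ilog.
  have [t_lt_a|a_lt_t|] := ltgtP t a; last by move/eqP; rewrite (negbTE ta).
    (* Once [eps] is below the distance from [t] to [[a, b]], the truncation removes nothing: one
       piece is empty, the other is all of [[a, b]], and the truncated integral is constant. *)
    apply: cvg_near_cst; near=> eps; have eps0 : 0 < eps by [].
    have epsa : eps < a - t by near: eps; apply: nbhs_right_lt; rewrite subr_gt0.
    rewrite mhilbert_trunc_split// far ?gt_min; last by apply/orP; right; lra.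
    rewrite max_l; last by lra.
    by rewrite add0r ibp ?t_lt_a ?orbT// logE//; ring.
  have [t_lt_b|b_lt_t|] := ltgtP t b; last by move/eqP; rewrite (negbTE tb).
    have L := left_truncation_cvg hT a0 bT ht hfc ih ih2 fh (ihk _ ht) a_lt_t (ltW t_lt_b).
    have Rt := right_truncation_cvg hT a0 bT ht hfc ih ih2 fh (ihk _ ht) (ltW a_lt_t) t_lt_b.
    have t0T : 0 < t < T by rewrite t0.
    (* [K] gives back the two compensating terms of [L] and [Rt]; its limit [f t * 0] is kept as a
       summand so that the three limits add up literally. *)
    have K : f t * (log_kernel T (t + eps) t - log_kernel T (t - eps) t)
        @[eps --> 0^'+] --> f t * 0.
      by apply: cvgM; [exact: cvg_cst|exact: log_kernel_sym_cvg].
    rewrite (_ : _ + log_kernel_integral _ _ _ _ _ =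
      f a * log_kernel T a t + \int[mu]_(s in `[a, t]) (h s * log_kernel T s t) +
      (- f b * log_kernel T b t + \int[mu]_(s in `[t, b]) (h s * log_kernel T s t)) +
      f t * 0); last first.
      rewrite logE// (Rintegral_itvcc_split (ihk _ ht) (ltW a_lt_t) (ltW t_lt_b)).
      by ring.
    apply: cvg_trans (cvgD (cvgD L Rt) K); apply: near_eq_cvg.
    near=> eps; have eps0 : 0 < eps by [].
    have epsa : eps < t - a by near: eps; apply: nbhs_right_lt; rewrite subr_gt0.
    have epsb : eps < b - t by near: eps; apply: nbhs_right_lt; rewrite subr_gt0.
    rewrite mhilbert_trunc_split// min_r ?max_r; try lra.
    by rewrite !fctE; ring.
  apply: cvg_near_cst; near=> eps; have eps0 : 0 < eps by [].
  have epsb : eps < t - b by near: eps; apply: nbhs_right_lt; rewrite subr_gt0.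
  rewrite mhilbert_trunc_split// [X in _ + X]far ?lt_max; last by apply/orP; right; lra.
  rewrite min_l; last by lra.
  by rewrite addr0 ibp ?b_lt_t// logE//; ring.
- move=> fa0.
  suff : mhilbert_trunc T vf a eps @[eps --> 0^'+] -->
      - f b * log_kernel T b a + log_kernel_integral T a b df a.
    by move=> /mhilbert_of_cvg[pv ->]; split => //; exact: ilog.
  have Rt := right_truncation_cvg hT a0 bT ha hfc ih ih2 fh (ihk _ ha) (lexx a) hab.
  rewrite logE//; move: Rt; apply: cvg_trans; apply: near_eq_cvg.
  near=> eps; have eps0 : 0 < eps by [].
  (* The left piece is empty, as its upper bound is at most [a - eps]; with [f a = 0] the
     compensating term of [Rt] is identically 0. *)
  rewrite mhilbert_trunc_split// [X in _ = X + _]far ?gt_min ?gtrBl ?eps0 ?orbT//.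
  by rewrite max_r ?lerDl ?(ltW eps0)// fa0 mul0r subr0 add0r.
- move=> fb0.
  suff : mhilbert_trunc T vf b eps @[eps --> 0^'+] -->
      f a * log_kernel T a b + log_kernel_integral T a b df b.
    by move=> /mhilbert_of_cvg[pv ->]; split => //; exact: ilog.
  have L := left_truncation_cvg hT a0 bT hb hfc ih ih2 fh (ihk _ hb) hab (lexx b).
  rewrite logE//; move: L; apply: cvg_trans; apply: near_eq_cvg.
  near=> eps; have eps0 : 0 < eps by [].
  rewrite mhilbert_trunc_split// [X in _ = _ + X]far ?lt_max ?ltrDl ?eps0 ?orbT//.
  by rewrite min_r ?gerBl ?(ltW eps0)// fb0 mul0r.
Unshelve. all: by end_near. Qed.
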